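(* Let $\kappa$ be an infinite cardinal and suppose $\theta$ is a complete sentence of $\mathcal{L}_{\omega_1,\omega}$ that homogeneously characterizes $\kappa$. Then there is a complete sentence $\psi=\psi_\theta$ of $\mathcal{L}_{\omega_1,\omega}$ such that $\psi$ characterizes $\kappa^+$ and $\psi$ has a maximal model of cardinality $\kappa$ and a maximal model of cardinality $\kappa^+$.
   Context: All vocabularies are countable. A satisfiable $\mathcal{L}_{\omega_1,\omega}$-sentence $\phi$ is complete if for every $\mathcal{L}_{\omega_1,\omega}$-sentence $\sigma$ of its vocabulary, $\phi\models\sigma$ or $\phi\models\neg\sigma$; such a $\phi$ has a unique countable model up to isomorphism. A model $\mathcal{N}$ of a complete sentence $\phi$ is maximal if it has no proper $\mathcal{L}_{\omega_1,\omega}$-elementary extension. A sentence $\phi$ characterizes an infinite cardinal $\mu$ if it has a model of cardinality $\mu$ and no model of cardinality $\mu^+$ (hence none larger). For a countable structure $\mathcal{M}$ and a unary predicate $P$, $P^{\mathcal{M}}$ is a set of absolute indiscernibles for $\mathcal{M}$ if $P^{\mathcal{M}}$ is infinite and every permutation of $P^{\mathcal{M}}$ extends to an automorphism of $\mathcal{M}$. Let $\phi$ be a complete $\mathcal{L}_{\omega_1,\omega}$-sentence in a vocabulary containing a distinguished unary predicate $P$, with countable model $\mathcal{M}$. The sentence $\phi$ homogeneously characterizes $\kappa$ if (a) $\phi$ has no model of size $\kappa^+$; (b) $P^{\mathcal{M}}$ is a set of absolute indiscernibles for the countable model $\mathcal{M}$; and (c) $\phi$ has a maximal model $\mathcal{N}$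 with $|\mathcal{N}|=|P^{\mathcal{N}}|=\kappa$. *)

(* Defs.v *)
From mathcomp Require Import all_boot.
From mathcomp Require Import wochoice boolp classical_sets functions cardinality.

Set Implicit Arguments.
Unset Strict Implicit.
Unset Printing Implicit Defensive.

Local Open Scope classical_set_scope.
Local Open Scope card_scope.

(* Throughout, a cardinal is represented by a type having that cardinality. *)

Definition card_lt (K L : Type) : Prop :=
  [set: K] #<= [set: L] /\ ~ ([set: L] #<= [set: K]).

(* L has cardinality K^+, the least cardinal above K; such an L exists for
   every K, see [card_succ_exists] below. *)
Definition is_card_succ (K L : Type) : Prop :=
  card_lt K L /\ forall T : Type, card_lt K T -> [set: L] #<= [set: T].

(* Constants are function symbols of arity 0. *)
Record vocabulary := Vocabulary {
  fsym : countType;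
  farity : fsym -> nat;
  rsym : countType;
  rarity : rsym -> nat }.

Record structure (V : vocabulary) := Structure {
  carrier :> Type;
  carrier_inhabited : inhabited carrier;
  finterp : forall f : fsym V, ('I_(farity f) -> carrier) -> carrier;
  rinterp : forall r : rsym V, ('I_(rarity r) -> carrier) -> Prop }.

Arguments finterp {V} s f _ : rename.
Arguments rinterp {V} s r _ : rename.

Inductive term (V : vocabulary) (n : nat) : Type :=
| Var of 'I_n
| App (f : fsym V) of ('I_(farity f) -> term V n).

(* [formula V n] is the type of L_{omega_1,omega}-formulas whose free variables
   are among x_0, ..., x_{n-1}. In [Ex phi] the variable 0 of phi is bound and
   its variable i+1 is the variable i of [Ex phi]. Countable disjunctions,
   universal quantifiers, and finite or empty conjunctions are expressible from
   the given connectives. *)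
Inductive formula (V : vocabulary) : nat -> Type :=
| Eq n of term V n & term V n : formula V n
| Rel n (r : rsym V) of ('I_(rarity r) -> term V n) : formula V n
| Neg n of formula V n : formula V n
| Conj n of (nat -> formula V n) : formula V n
| Ex n of formula V n.+1 : formula V n.

Definition sentence (V : vocabulary) := formula V 0.

Fixpoint eval V (M : structure V) n (v : 'I_n -> M) (t : term V n) : M :=
  match t with
  | Var i => v i
  | App f ts => finterp M f (fun i => eval v (ts i))
  end.

Definition extend_env (M : Type) n (a : M) (v : 'I_n -> M) : 'I_n.+1 -> M :=
  fun i => if unlift ord0 i is Some j then v j else a.

Fixpoint sat V (M : structure V) n (phi : formula V n) : ('I_n -> M) -> Prop :=
  match phi in formula _ n return ('I_n -> M) -> Prop with
  | Eq _ t u => fun v => eval v t = eval v u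
  | Rel _ r ts => fun v => rinterp M r (fun i => eval v (ts i))
  | Neg _ psi => fun v => ~ sat psi v
  | Conj _ psis => fun v => forall k, sat (psis k) v
  | Ex _ psi => fun v => exists a : M, sat psi (extend_env a v)
  end.

Definition empty_env (M : Type) : 'I_0 -> M :=
  fun i => False_rect M (notF (ltn_ord i)).

Definition models V (M : structure V) (phi : sentence V) : Prop :=
  sat phi (@empty_env M).

Definition entails V (phi sigma : sentence V) : Prop :=
  forall M : structure V, models M phi -> models M sigma.

Definition complete V (phi : sentence V) : Prop :=
  (exists M : structure V, models M phi) /\
  forall sigma : sentence V, entails phi sigma \/ entails phi (Neg sigma).

Definition elementary V (M N : structure V) (j : M -> N) : Prop :=
  forall n (phi : formula V n) (v : 'I_n -> M),
    sat phi v <-> sat phi (fun i => j (v i)).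

(* Up to identification of N with its image, the elementary extensions of N are
   the elementary maps out of N, the proper ones being those that are not
   onto. Elementary maps are injective, because of the formula x_0 = x_1. *)
Definition is_maximal V (N : structure V) : Prop :=
  ~ exists (N' : structure V) (j : N -> N'),
      elementary j /\ exists b : N', forall a : N, j a <> b.

Definition has_card V (M : structure V) (K : Type) : Prop :=
  [set: M] #= [set: K].

Definition no_model_of_card_succ V (phi : sentence V) (K : Type) : Prop :=
  ~ exists M : structure V, models M phi /\ is_card_succ K M.

Definition characterizes V (phi : sentence V) (K : Type) : Prop :=
  [/\ infinite_set [set: K],
      exists M : structure V, models M phi /\ has_card M K
    & no_model_of_card_succ phi K].

Definition automorphism V (M : structure V) (g : M -> M) : Prop :=
  [/\ bijective g,
      forall f (a : 'I_(farity f) -> M),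
        g (finterp M f a) = finterp M f (fun i => g (a i))
    & forall r (a : 'I_(rarity r) -> M),
        rinterp M r a <-> rinterp M r (fun i => g (a i))].

(* The interpretation of P, which is meant to be a unary symbol. *)
Definition pred_set V (M : structure V) (P : rsym V) : set M :=
  [set x | rinterp M P (fun=> x)].
Arguments pred_set {V} M P _.

Definition absolute_indiscernibles V (M : structure V) (P : rsym V) : Prop :=
  infinite_set (pred_set M P) /\
  forall s : M -> M, set_bij (pred_set M P) (pred_set M P) s ->
    exists2 g : M -> M, automorphism g & forall x, pred_set M P x -> g x = s x.

(* For complete phi the countable model is unique up to isomorphism, so that
   the existential quantifier over it is a definite description. *)
Definition homogeneously_characterizes V (P : rsym V) (phi : sentence V)
    (K : Type) : Prop :=
  [/\ no_model_of_card_succ phi K,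
      exists M : structure V,
        [/\ models M phi, countable [set: M] & absolute_indiscernibles M P]
    & exists N : structure V,
        [/\ models N phi, is_maximal N, has_card N K
          & pred_set N P #= [set: K]]].

Lemma wo_rel (T : Type) : exists R : T -> T -> Prop,
  well_founded R /\ forall x y, R x y \/ x = y \/ R y x.
Proof.
have [R woR] := well_ordering_principle {classic T}.
have refl (x : {classic T}) : R x x.
  have [|m [[mA lbm] _]] := woR (pred1 x); first by exists x; exact: eqxx.
  by have := lbm _ mA; have -> : m = x by exact/eqP.
have anti (x y : {classic T}) : R x y -> R y x -> x = y.
  move=> Rxy Ryx; have [|m [_ mU]] := woR (pred2 x y).
    by exists x; rewrite inE eqxx.
  rewrite -(mU x); last first.
    by split; [rewrite inE eqxx|move=> z /pred2P[] ->].
  by apply: mU; split; [rewrite inE eqxx orbT|move=> z /pred2P[] ->].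
exists (fun x y => (R x y : Prop) /\ x <> y); split.
- move=> x; apply: contrapT => nAx.
  have [|m [[mA lbm] _]] :=
    woR [pred z | `[< ~ Acc (fun x y => (R x y : Prop) /\ x <> y) z >]].
    by exists x; apply/asboolP.
  move/asboolP: mA; apply; constructor=> y [Rym neq].
  apply: contrapT => nAy.
  have /lbm Rmy : y \in [pred z | `[< ~ Acc (fun x y => (R x y : Prop) /\ x <> y) z >]].
    exact/asboolP.
  by apply: neq; apply: anti.
- move=> x y; have [<-|xy] := pselect (x = y); first by right; left.
  have [|m [[mA lbm] _]] := woR [pred z : {classic T} | (z == x) || (z == y)].
    by exists x; rewrite inE eqxx.
  have mx : R m x by apply: lbm; rewrite inE eqxx.
  have my : R m y by apply: lbm; rewrite inE eqxx orbT.
  move: mA; rewrite inE => /orP[] /eqP E.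
    by left; split=> //; rewrite -E.
  by right; right; split; [rewrite -E|move=> yx; apply: xy].
Qed.

Lemma wo_card_le (T X : Type) (R : T -> T -> Prop) (A : set T) :
  well_founded R -> (forall x y, R x y \/ x = y \/ R y x) ->
  (forall s, A s -> ~ ([set: X] #<= [set t | R t s])) ->
  A #<= [set: X].
Proof.
move=> wfR triR nle.
have [[s0 As0]|A0] := pselect (exists s, A s); last first.
  suff -> : A = set0 by exact: card_ge0.
  by apply/seteqP; split=> // s As; case: A0; exists s.
have [x0 _] : exists x : X, True.
  apply: contrapT => nX; apply: (nle _ As0).
  suff -> : [set: X] = set0 by exact: card_ge0.
  by apply/seteqP; split=> // x _; case: nX; exists x.
pose step s (rec : forall t, R t s -> X) : X :=
  xget (x0 : {classic X}) [set x : {classic X} | forall t (h : R t s), rec t h <> x].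
pose f := Fix wfR (fun=> X) step.
have fE s : f s = xget (x0 : {classic X}) [set x : {classic X} | forall t, R t s -> f t <> x].
  rewrite /f Fix_eq // => {}s g h gh; suff -> : g = h by [].
  by do 2!apply: functional_extensionality_dep => ?.
have fP s t : A s -> R t s -> f t <> f s.
  move=> As Rts; rewrite [f s]fE.
  case: xgetP => [x _ H|nH]; first exact: H.
  exfalso; apply: (nle s As).
  apply: (@card_le_trans _ _ _ (f @` [set t | R t s])); last exact: card_image_le.
  apply: subset_card_le => x _; apply: contrapT => nx.
  by apply: (nH x) => u Rus fux; apply: nx; exists u.
have finj : set_inj A f.
  move=> x y /set_mem Ax /set_mem Ay fxy.
  have [r|[//|r]] := triR x y; first by case: (fP y x).
  by case: (fP x y).
by rewrite -(card_le_eql (inj_card_eq finj)); apply: subset_card_le.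
Qed.

Lemma card_le_total (T X : Type) :
  [set: T] #<= [set: X] \/ [set: X] #<= [set: T].
Proof.
have [R [wfR triR]] := wo_rel T.
have [[s le]|n] := pselect (exists s, [set: X] #<= [set t | R t s]).
  by right; apply: card_le_trans le _; apply: subset_card_le.
by left; apply: wo_card_le wfR triR _ => s _ le; apply: n; exists s.
Qed.

Lemma cantor (K : Type) : ~ ([set: set K] #<= [set: K]).
Proof.
elim/Ppointed: K => K.
  by rewrite emptyE => /eqP E; have : [set: set K] set0 by []; rewrite E.
move=> /pcard_injP[g ginj].
pose D : set K := [set x | exists2 B, g B = x & ~ B x].
have nD : ~ D (g D).
  move=> /[dup] DD [B gB nB].
  have E : B = D by apply: ginj => //; exact: mem_set.
  by apply: nB; rewrite E.
by apply: (nD); exists D.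
Qed.

Lemma card_succ_exists (K : Type) : exists L : Type, is_card_succ K L.
Proof.
have [R [wfR triR]] := wo_rel (set K).
have [A nAK leA] : exists2 A : set (set K), ~ (A #<= [set: K]) &
    forall s, A s -> [set t | R t s] #<= [set: K].
  have [H|nH] := pselect (forall s, [set t | R t s] #<= [set: K]).
    by exists setT => // /cantor.
  have [s ns] : exists s, ~ ([set t | R t s] #<= [set: K]).
    by apply: contrapT => h; apply: nH => s; apply: contrapT => h'; apply: h; exists s.
  elim: s / (wfR s) ns => s _ IH ns.
  have [[t Rts nt]|h] :=
    pselect (exists2 t, R t s & ~ ([set u | R u t] #<= [set: K])).
    exact: IH t Rts nt.
  exists [set t | R t s] => // t Rts.
  by apply: contrapT => nt; apply: h; exists t.
exists (set_type A).
have EA := card_setT A.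
have nL : ~ ([set: set_type A] #<= [set: K]) by rewrite (card_le_eql EA).
split; first by split=> //; have [] := card_le_total K (set_type A).
move=> T [_ nT]; rewrite (card_le_eql EA).
apply: wo_card_le wfR triR _ => s As le.
by apply: nT; apply: card_le_trans le (leA s As).
Qed.

(* Main.v *)
(* The vocabulary of psi adds a new sort L to models of theta, a subset U of P
   with infinite complement in P, a dense strict weak order on L without
   endpoints, and a map g : L * U -> L with g(a,u) = a or g(a,u) < a. The axioms
   say that finite patterns are realized freely, both by elements u of U
   ([f_row]) and by elements of any level of L ([f_point]), and that finitely
   many u's generate finite sets ([f_finite]). Every initial segment of L is then
   the image of some g(a,.), so |L| <= |U|^+ <= |P|^+.

   Countable models of psi are isomorphic: back and forth through finite closed
   sets handles U and L, the resulting bijection of U extends to P, and absolute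
   indiscernibility lifts it to the theta-part. With downward Loewenheim-Skolem,
   psi is complete.

   A model whose theta-part is maximal and in which |L| > |U| is maximal: U cannot
   grow, hence initial segments of L cannot either, and a new element above all
   of L would embed L into U. So it suffices to build, for infinite D, such a
   model with |U| = |D| and |L| = |D|^+. Taking D = K gives cardinality K^+, and
   taking D = nat gives cardinality K, as K is uncountable: the countable model of
   theta carries absolute indiscernibles and is therefore not maximal. *)

Require Import Defs.
From mathcomp Require Import all_boot.
From mathcomp Require Import boolp classical_sets functions cardinality.
From mathcomp Require Import order ssralg ssrnum rat.
From Stdlib Require List.
From Stdlib Require Import Inverse_Image Lexicographic_Product Relation_Operators.

Set Implicit Arguments.
Unset Strict Implicit.
Unset Printing Implicit Defensive.

(** Two demands pull against each other. The cardinality bound and maximality need g(a,.) to reach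
    everything below a, and [f_row] asks this freely for finitely many rows at once; in the model
    with |L| = |D|^+ only |D| many u are available, which suffices because |D|^+ <= 2^|D|.
    Completeness, on the other hand, needs finite sets closed under g in a dense order. The value
    g(a,u) = a reconciles the two: a point of lowest level in a finite closed set has no other value
    left.

    L is only weakly ordered so that the position of a point and its row under g can be prescribed
    independently: the order axioms fill a cut, and [f_point] then finds the row inside that level.

    The complement of U in P must be infinite, as its size could otherwise vary among countable
    models. Absolute indiscernibility serves twice: it lifts bijections of P, and by a category
    argument on automorphisms it gives the countable model of theta a proper elementary
    self-embedding, whence nat^+ <= K. *)

(** * Embeddings between types *)

Local Open Scope classical_set_scope.
Local Open Scope card_scope.

Definition embeds (X Y : Type) := exists f : X -> Y, injective f.

Lemma embeds_refl X : embeds X X.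
Proof. by exists id. Qed.

Lemma embeds_trans Y X Z : embeds X Y -> embeds Y Z -> embeds X Z.
Proof. by move=> [f fi] [g gi]; exists (g \o f); apply: inj_comp. Qed.

Lemma sval_inj X (A : X -> Prop) : injective (@sval X A).
Proof. by move=> x y; apply: eq_sig_hprop => *; apply: Prop_irrelevance. Qed.

Lemma card_le_embeds X Y (A : set X) (B : set Y) :
  A #<= B <-> embeds {x | A x} {y | B y}.
Proof.
split.
  move=> /card_leP/injfunPex[f _ fi].
  exists (fun a : {x | A x} => let b := f (SigSub (mem_set (svalP a))) in
     exist _ (val b) (set_mem (valP b))).
  move=> [x Ax] [y Ay] /= /(congr1 sval) /= /val_inj e.
  have := fi _ _ (mem_set I) (mem_set I) e => /(congr1 val) /= exy.
  exact: sval_inj.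
move=> [f fi]; apply/card_leP/injfunPex.
exists (fun a : A => let b := f (exist _ _ (set_mem (valP a))) in
     SigSub (mem_set (svalP b)) : B) => //.
move=> x y _ _ /= /(congr1 val) /= e; apply: val_inj.
by move/sval_inj/fi: e => /(congr1 sval).
Qed.

Lemma embeds_sigT X : embeds X {x | [set: X] x}.
Proof. by exists (fun x => exist _ x I) => x y /(congr1 sval). Qed.

Lemma embeds_sig X (A : X -> Prop) : embeds {x | A x} X.
Proof. by exists sval; exact: sval_inj. Qed.

Lemma embeds_sig2 X Y (A : X -> Prop) (B : Y -> Prop) (f : X -> Y) :
  (forall x, A x -> B (f x)) -> (forall x y, A x -> A y -> f x = f y -> x = y) ->
  embeds {x | A x} {y | B y}.
Proof.
move=> AB fi; exists (fun x => exist B (f (sval x)) (AB _ (svalP x))).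
move=> [x Ax] [y Ay] /(congr1 sval) /= /fi e.
by apply: sval_inj; apply: e.
Qed.

Lemma embedsP (X Y : Type) : [set: X] #<= [set: Y] <-> embeds X Y.
Proof.
rewrite card_le_embeds; split=> h.
  apply: embeds_trans (embeds_sigT X) _; apply: embeds_trans h _; exact: embeds_sig.
apply: embeds_trans (embeds_sig _) _; apply: embeds_trans h _; exact: embeds_sigT.
Qed.

Lemma equipotentP (X Y : Type) : [set: X] #= [set: Y] <-> embeds X Y /\ embeds Y X.
Proof.
rewrite -!embedsP; split=> [e|[h h']]; last by apply/Cantor_Bernstein.
by split; [|have e' := card_esym e]; move/card_eqPle: e => [] .
Qed.

Lemma infiniteP_embeds X : infinite_set [set: X] <-> embeds nat X.
Proof. by rewrite infiniteP embedsP. Qed.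

Lemma embeds_total X Y : embeds X Y \/ embeds Y X.
Proof. by rewrite -!embedsP; apply: card_le_total. Qed.

Lemma embeds_prod X X' Y Y' : embeds X X' -> embeds Y Y' -> embeds (X * Y) (X' * Y').
Proof.
by move=> [f fi] [g gi]; exists (fun p => (f p.1, g p.2)) => -[x y] [x' y'] [/= /fi-> /gi->].
Qed.

Lemma embeds_sum X X' Y Y' : embeds X X' -> embeds Y Y' -> embeds (X + Y) (X' + Y').
Proof.
move=> [f fi] [g gi].
exists (fun p => match p with inl x => inl (f x) | inr y => inr (g y) end).
by move=> [x|y] [x'|y'] // [] => [/fi->|/gi->].
Qed.

Lemma embeds_surj X Y (f : X -> Y) : (forall y, exists x, f x = y) -> embeds Y X.
Proof.
move=> /choice[g gP]; exists g => x y e; by rewrite -(gP x) e gP.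
Qed.

Lemma embeds_option X : embeds nat X -> embeds (option X) X.
Proof.
move=> [f fi]; pose P x n := f n = x.
have [h hP] : exists h : X -> option nat, forall x n, h x = Some n <-> f n = x.
  have /choice[h hP] : forall x, exists o : option nat, forall n, o = Some n <-> f n = x.
    move=> x; have [[n nx]|no] := pselect (exists n, f n = x).
      by exists (Some n) => m; split=> [[<-]//|]; rewrite -nx => /fi->.
    by exists None => m; split=> // e; case: no; exists m.
  by exists h.
exists (fun o => if o is Some x then if h x is Some n then f n.+1 else x else f 0).
have h0 x n : h x = None -> x <> f n.
  by move=> hx e; have /hP := esym e; rewrite hx.
move=> [x|] [y|] //=.
- case ex: (h x) => [n|]; case ey: (h y) => [m|].
  + by move=> /fi[e]; move/hP: ex => <-; move/hP: ey => <-; rewrite e.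
  + by move=> e; case: (h0 y n.+1).
  + by move=> e; case: (h0 x m.+1).
  + by move=> ->.
- by case ex: (h x) => [n|] => [/fi|/(h0 _ _ ex)].
- by case ex: (h y) => [n|] => [/fi|/esym /(h0 _ _ ex)].
Qed.

Section WellOrder.
Variables (T : Type) (R : T -> T -> Prop).
Hypotheses (wfR : well_founded R) (triR : forall x y, R x y \/ x = y \/ R y x).

Lemma wo_irr x : ~ R x x.
Proof. by elim: x / (wfR x) => x _ IH /[dup] /IH. Qed.

Lemma wo_asym x y : R x y -> ~ R y x.
Proof. by elim: x / (wfR x) y => x _ IH y Rxy Ryx; exact: (IH y Ryx x). Qed.

Lemma wo_trans x y z : R x y -> R y z -> R x z.
Proof.
move=> xy yz; have [//|[e|zx]] := triR x z; first by case: (wo_asym xy); rewrite e.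
exfalso; elim: x / (wfR x) y z xy yz zx => x _ IH y z xy yz zx.
exact: (IH z zx x y).
Qed.

End WellOrder.

Lemma finite_embeds X Y : embeds X Y -> finite_set [set: Y] -> finite_set [set: X].
Proof. by rewrite -embedsP => h; apply: card_le_finite. Qed.

Lemma finite_prod_type X Y :
  finite_set [set: X] -> finite_set [set: Y] -> finite_set [set: X * Y].
Proof.
by move=> fX fY; have := finite_setX fX fY; congr (finite_set _); apply/seteqP; split.
Qed.

Lemma finite_option X : finite_set [set: X] -> finite_set [set: option X].
Proof.
move=> fX; have -> : [set: option X] = [set None] `|` some @` [set: X].
  by apply/seteqP; split=> // -[x|] _; [right; exists x|left].
by rewrite finite_setU; split; [exact: finite_set1|exact: finite_image].
Qed.

(* Hessenberg's argument: pairs are compared by maximum first, so that every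
   proper initial segment of K * K is contained in a square of smaller size. *)
Lemma embeds_square_step (K : Type) (R : K -> K -> Prop) :
  well_founded R -> (forall x y, R x y \/ x = y \/ R y x) -> embeds nat K ->
  (forall s, embeds nat {t | R t s} -> embeds ({t | R t s} * {t | R t s}) {t | R t s}) ->
  embeds (K * K) K.
Proof.
move=> wfR triR infK IH.
(* If K already embeds into a proper initial segment, [IH] finishes. Otherwise R behaves like an
   initial ordinal, and [noK] is what a large segment of pairs will contradict. *)
have [[s Ks]|noK] := pselect (exists s, embeds K {t | R t s}).
  apply: embeds_trans (embeds_prod Ks Ks) _.
  apply: embeds_trans (IH s _) (embeds_sig _); exact: embeds_trans infK Ks.
have /choice[mx mxP] : forall p : K * K, exists m,
    (p.1 = m \/ R p.1 m) /\ (p.2 = m \/ R p.2 m).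
  move=> [x y] /=; have [xy|[->|yx]] := triR x y.
  - by exists y; split; [right|left].
  - by exists y; split; left.
  - by exists x; split; [left|right].
pose lex2 := slexprod K K R R.
pose lex3 := slexprod K (K * K) R lex2.
pose Q (p q : K * K) := lex3 (mx p, p) (mx q, q).
have wfQ : well_founded Q.
  apply: (@wf_inverse_image (K * K) (K * (K * K)) lex3 (fun p => (mx p, p))).
  exact: wf_slexprod wfR (wf_slexprod _ _ _ _ wfR wfR).
have triQ p q : Q p q \/ p = q \/ Q q p.
  rewrite /Q /lex3; move: (mx p) (mx q) => a b.
  have [ab|[<-|ba]] := triR a b; first by left; left.
    case: p q => [x y] [x' y'].
    have [xx|[<-|xx]] := triR x x'; first by left; right; left.
      have [yy|[<-|yy]] := triR y y'; first by left; right; right.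
        by right; left.
      by right; right; right; right.
    by right; right; right; left.
  by right; right; left.
rewrite -embedsP; apply: (wo_card_le wfQ triQ) => s _ le; apply: noK.
set m := mx s.
(* Both coordinates of a pair below [s] are at most [m]; [None] codes [m] itself. *)
have Kmm : embeds K (option {t | R t m} * option {t | R t m}).
  move: le; rewrite card_le_embeds => /(embeds_trans (embeds_sigT K)) h.
  apply: (embeds_trans h).
  have key x : x = m \/ R x m -> exists o : option {t | R t m},
      if o is Some t then sval t = x else x = m.
    by move=> [->|xm]; [exists None|exists (Some (exist _ x xm))].
  have /choice[f fP] : forall x, exists o : option {t | R t m}, x = m \/ R x m ->
      if o is Some t then sval t = x else x = m.
    move=> x.
    have [/key[o oP]|n] := pselect (x = m \/ R x m); first by exists o.
    by exists None.
  have finj x y : x = m \/ R x m -> y = m \/ R y m -> f x = f y -> x = y.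
    move=> /fP hx /fP hy e; move: hx hy; rewrite e.
    by case: (f y) => [t <- <-|-> ->].
  have le_m p : Q p s -> forall x, x = mx p \/ R x (mx p) -> x = m \/ R x m.
    move=> Qps x xp; have pm : mx p = m \/ R (mx p) m.
      by inversion Qps; subst; [right|left].
    case: xp => [->//|xp]; case: pm => [<-|pm]; first by right.
    by right; apply: wo_trans xp pm.
  exists (fun p => (f (sval p).1, f (sval p).2)) => -[[x y] /= Qp] [[x' y'] /= Qp'] [e1 e2].
  apply: sval_inj => /=.
  have [h1 h2] := mxP (x, y); have [h1' h2'] := mxP (x', y').
  have := le_m _ Qp _ h1; have := le_m _ Qp _ h2.
  have := le_m _ Qp' _ h1'; have := le_m _ Qp' _ h2' => /= a b c d.
  by rewrite (finj _ _ d b e1) (finj _ _ c a e2).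
exists m; have [fin|inf] := pselect (finite_set [set: {t | R t m}]).
  exfalso; apply: (proj2 (infiniteP_embeds K) infK); apply: (finite_embeds Kmm).
  by apply: finite_prod_type; apply: finite_option.
move/infiniteP_embeds: inf => inf.
apply: embeds_trans Kmm _; apply: embeds_trans (IH m inf).
by apply: embeds_prod; apply: embeds_option.
Qed.

(** Well-founded induction on segments: in the order restricted to the segment below [s], the
    initial segments are those below the smaller [r], so the step lemma applies again. *)
Lemma embeds_square (K : Type) : embeds nat K -> embeds (K * K) K.
Proof.
move=> infK; have [R [wfR triR]] := wo_rel K.
apply: (embeds_square_step wfR triR infK) => s.
elim: s / (wfR s) => s _ IH infs.
pose Rs (x y : {t | R t s}) := R (sval x) (sval y).
apply: (@embeds_square_step _ Rs _ _ infs).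
- exact: wf_inverse_image.
- move=> x y; have [|[/sval_inj|]] := triR (sval x) (sval y); rewrite /Rs; tauto.
move=> [r rs] infr.
have e1 : embeds {t : {t | R t s} | Rs t (exist _ r rs)} {t | R t r}.
  apply: (@embeds_sig2 _ _ _ _ sval) => // x y _ _; exact: sval_inj.
have e2 : embeds {t | R t r} {t : {t | R t s} | Rs t (exist _ r rs)}.
  exists (fun t => exist (fun t : {t | R t s} => Rs t (exist _ r rs))
    (exist _ (sval t) (wo_trans wfR triR (svalP t) rs)) (svalP t)).
  by move=> x y /(congr1 (fun z => sval (sval z))) /= /sval_inj.
apply: embeds_trans (embeds_prod e1 e1) _; apply: embeds_trans e2.
by apply: IH => //; apply: embeds_trans infr e1.
Qed.

Lemma embeds_sum_inf X Y K : embeds nat K -> embeds X K -> embeds Y K -> embeds (X + Y) K.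
Proof.
move=> infK XK YK; apply: embeds_trans (embeds_sum XK YK) _.
apply: embeds_trans (embeds_square infK).
have [n ni] := infK.
exists (fun p => match p with inl x => (n 0, x) | inr x => (n 1, x) end).
by move=> [x|x] [y|y] [] // => [->|/ni|/ni|->].
Qed.

Lemma embeds_prod_inf X Y K : embeds nat K -> embeds X K -> embeds Y K -> embeds (X * Y) K.
Proof.
move=> infK XK YK; apply: embeds_trans (embeds_prod XK YK) _; exact: embeds_square.
Qed.

Lemma embeds_seq X K : embeds nat K -> embeds X K -> embeds (seq X) K.
Proof.
move=> infK [h hi]; have [p pi] := embeds_square infK.
have [n ni] := infK.
(* the length is coded separately, so that lists of equal length are compared *)
apply: embeds_trans (embeds_square infK).
exists (fun s => (n (size s), foldr (fun x k => p (h x, k)) (n 0) s)) => s t [/ni].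
elim: s t => [|x s IH] [|y t] //= [e] /pi[/hi-> k].
by rewrite (IH _ e k).
Qed.

(** * Successor cardinals in terms of [embeds] *)

Lemma card_succP K L : is_card_succ K L <->
  ~ embeds L K /\ forall T, ~ embeds T K -> embeds L T.
Proof.
rewrite /is_card_succ /card_lt !embedsP; split.
  move=> [[KL nLK] min]; split=> // T nTK; apply/embedsP; apply: min.
  by rewrite !embedsP; split=> //; case: (embeds_total K T).
move=> [nLK min]; split; first by split=> //; case: (embeds_total K L).
by move=> T; rewrite !embedsP => -[_ /min].
Qed.

Lemma card_succ_embeds K L : is_card_succ K L -> embeds K L.
Proof. by move=> [[/embedsP]]. Qed.

(** Unless all segments of a well-order of L are already small, the least [s] whose segment does not
    embed into K plays the initial ordinal K^+: by minimality L embeds into that segment and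
    inherits its order. *)
Lemma card_succ_wo K L : is_card_succ K L -> exists R : L -> L -> Prop,
  [/\ well_founded R, forall x y, R x y \/ x = y \/ R y x
    & forall s, embeds {t | R t s} K].
Proof.
move=> /card_succP[nLK min]; have [R [wfR triR]] := wo_rel L.
have [H|/existsNP[s0 ns0]] := pselect (forall s, embeds {t | R t s} K).
  by exists R.
have [s [ns lts]] : exists s, ~ embeds {t | R t s} K /\
    forall t, R t s -> embeds {u | R u t} K.
  elim: s0 / (wfR s0) ns0 => s _ IH ns.
  have [h|/existsNP[t /not_implyP[Rts nt]]] :=
    pselect (forall t, R t s -> embeds {u | R u t} K); first by exists s.
  exact: IH Rts nt.
have [i iinj] := min _ ns.
exists (fun x y => R (sval (i x)) (sval (i y))); split.
- exact: wf_inverse_image.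
- move=> x y; have [|[/sval_inj/iinj|]] := triR (sval (i x)) (sval (i y)); tauto.
move=> x; apply: embeds_trans (lts _ (svalP (i x))).
apply: (@embeds_sig2 _ _ _ _ (fun y => sval (i y))) => // y z _ _.
by move/sval_inj/iinj.
Qed.

(** Cantor's theorem and the minimality of L, that is K^+ <= 2^K. It will give every block its own
    sequence of bits. *)
Lemma card_succ_bits K L : is_card_succ K L -> embeds L (K -> bool).
Proof.
move=> /card_succP[_]; apply=> h; apply: (@cantor K); rewrite embedsP.
apply: embeds_trans h; exists (fun (A : set K) x => `[< A x >]) => A B e.
apply/funext => x; have {}e : `[< A x >] = `[< B x >] by have := congr1 (@^~ x) e.
by apply/propext; split=> ?; apply/asboolP; [rewrite -e|rewrite e]; apply/asboolP.
Qed.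

Local Close Scope card_scope.
Local Close Scope classical_set_scope.

(** * Isomorphisms, elementary maps and the downward Loewenheim-Skolem theorem *)

Lemma extend_env0 M n (a : M) (v : 'I_n -> M) : extend_env a v ord0 = a.
Proof. by rewrite /extend_env unlift_none. Qed.

Lemma extend_envS M n (a : M) (v : 'I_n -> M) i : extend_env a v (lift ord0 i) = v i.
Proof. by rewrite /extend_env liftK. Qed.

Lemma extend_env_eta M n (w : 'I_n.+1 -> M) :
  extend_env (w ord0) (fun i => w (lift ord0 i)) = w.
Proof.
by apply/funext => i; case: (unliftP ord0 i) => [j|] ->; rewrite ?extend_envS ?extend_env0.
Qed.

Lemma extend_env_map M N (h : M -> N) n (a : M) (v : 'I_n -> M) :
  (fun i => h (extend_env a v i)) = extend_env (h a) (fun i => h (v i)).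
Proof.
apply/funext => i; case: (unliftP ord0 i) => [j|] ->; first by rewrite !extend_envS.
by rewrite !extend_env0.
Qed.

Lemma env0_eq M (v w : 'I_0 -> M) : v = w.
Proof. by apply/funext => -[]. Qed.

Section Isomorphism.
Variable V : vocabulary.

Definition isomorphism (M N : structure V) (h : M -> N) : Prop :=
  [/\ bijective h,
      forall f (a : 'I_(farity f) -> M), h (finterp M f a) = finterp N f (fun i => h (a i))
    & forall r (a : 'I_(rarity r) -> M), rinterp M r a <-> rinterp N r (fun i => h (a i))].

Lemma eval_hom (M N : structure V) (h : M -> N) :
  (forall f (a : 'I_(farity f) -> M), h (finterp M f a) = finterp N f (fun i => h (a i))) ->
  forall n (t : term V n) v, h (eval v t) = eval (fun i => h (v i)) t.
Proof.
move=> hf n t v; elim: t => //= f ts IH; rewrite hf; congr (finterp _ _ _).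
by apply/funext.
Qed.

Lemma isomorphism_elementary (M N : structure V) (h : M -> N) :
  isomorphism h -> elementary h.
Proof.
move=> [[g hK gK] hf hr] n phi v; elim: phi v => {n} [n t u|n r ts|n phi IH|n phi IH|n phi IH] v /=.
- rewrite -!(eval_hom hf); split=> [->//|]; exact: can_inj hK _ _.
- rewrite hr; have -> // : (fun i => h (eval v (ts i))) = fun i => eval (fun i => h (v i)) (ts i).
  by apply/funext => i; rewrite eval_hom.
- by rewrite IH.
- by split=> H k; have := H k; rewrite IH.
- split=> [[a]|[b]].
    by rewrite IH extend_env_map => H; exists (h a).
  by rewrite -{1}(gK b) -extend_env_map -IH => H; exists (g b).
Qed.

Lemma isomorphism_inv (M N : structure V) (h : M -> N) (g : N -> M) :
  isomorphism h -> cancel h g -> cancel g h -> isomorphism g.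
Proof.
move=> [_ hf hr] hK gK; split; first by exists h.
  move=> f a; apply: (can_inj hK); rewrite gK hf; congr (finterp _ _ _).
  by apply/funext => i; rewrite gK.
move=> r a; rewrite hr; have -> // : (fun i => h (g (a i))) = a.
by apply/funext => i; rewrite gK.
Qed.

Lemma isomorphism_comp (M N Q : structure V) (h : M -> N) (g : N -> Q) :
  isomorphism h -> isomorphism g -> isomorphism (g \o h).
Proof.
move=> [hb hf hr] [gb gf gr]; split; first exact: bij_comp.
  by move=> f a /=; rewrite hf gf.
by move=> r a; rewrite hr gr.
Qed.

Lemma elementary_comp (M N Q : structure V) (h : M -> N) (g : N -> Q) :
  elementary h -> elementary g -> elementary (g \o h).
Proof. by move=> he ge n phi v; rewrite he ge. Qed.

Lemma elementary_inj (M N : structure V) (h : M -> N) : elementary h -> injective h.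
Proof.
move=> he x y e; pose v (i : 'I_2) := if val i is 0 then x else y.
have /= := he 2 (Eq (Var V (@Ordinal 2 0 isT)) (Var V (@Ordinal 2 1 isT))) v.
by rewrite /v /= => -[_]; apply.
Qed.

Lemma elementary_models (M N : structure V) (h : M -> N) (phi : sentence V) :
  elementary h -> models M phi <-> models N phi.
Proof.
by move=> he; rewrite /models he (env0_eq (fun i => h _) (@empty_env N)).
Qed.

(** * Substructures, Skolem functions and hulls *)

Definition fclosed (M : structure V) (H : M -> Prop) :=
  forall f (a : 'I_(farity f) -> M), (forall i, H (a i)) -> H (finterp M f a).

Definition substructure (M : structure V) (H : M -> Prop) (clH : fclosed H)
    (inh : exists x, H x) : structure V :=
  @Structure V {x | H x} (let: ex_intro x Hx := inh in inhabits (exist _ x Hx))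
    (fun f a => exist _ (finterp M f (fun i => sval (a i))) (clH f _ (fun i => svalP (a i))))
    (fun r a => rinterp M r (fun i => sval (a i))).

Lemma substructure_eval (M : structure V) (H : M -> Prop) clH inh n
    (v : 'I_n -> @substructure M H clH inh) (t : term V n) :
  sval (eval v t) = eval (fun i => sval (v i)) t.
Proof.
by elim: t => //= f ts IH; congr (finterp _ _ _); apply/funext.
Qed.

Definition and_formula n (phi psi : formula V n) : formula V n :=
  Conj (fun k => if k is 0 then phi else psi).

Lemma sat_and (M : structure V) n (phi psi : formula V n) (v : 'I_n -> M) :
  sat (and_formula phi psi) v <-> sat phi v /\ sat psi v.
Proof.
by split=> [h|[h1 h2] [|k]//]; split; [exact: h 0|exact: h 1].
Qed.

(** A formula has countably many subformulas, so countably many functions suffice; they take lists,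
    which spares a bookkeeping of arities. Having the equivalence in both directions carries the
    induction through [Neg]. *)
Lemma skolem_functions (M : structure V) n (phi : formula V n) :
  exists F : nat -> seq M -> M, forall (H : M -> Prop) clH inh,
    (forall k s, (forall i x0, i < size s -> H (nth x0 s i)) -> H (F k s)) ->
    forall v : 'I_n -> @substructure M H clH inh,
      sat phi v <-> sat phi (fun i => sval (v i)).
Proof.
have [x0] := carrier_inhabited M.
elim: phi => {n} [n t u|n r ts|n phi [F IH]|n phi IH|n phi [F IH]].
- exists (fun _ _ => x0) => H clH inh _ v /=; rewrite -!substructure_eval.
  by split=> [->//|]; exact: sval_inj.
- exists (fun _ _ => x0) => H clH inh _ v /=.
  set a := fun i => _; set b := fun i => _; suff -> : a = b by [].
  by apply/funext => i; rewrite /a substructure_eval.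
- by exists F => H clH inh HF v /=; rewrite IH.
- have /choice[F FP] := IH.
  exists (fun k => if unpickle k is Some (i, j) then F i j else fun=> x0).
  move=> H clH inh HF v /=; split=> h k; have := h k; rewrite FP // => i s sH;
  by have := HF (pickle (k, i)) s sH; rewrite pickleK.
- pose env s b := extend_env b (fun i : 'I_n => nth x0 s i).
  have /choice[w wP] : forall s, exists a, (exists b, sat phi (env s b)) -> sat phi (env s a).
    move=> s; have [[b hb]|no] := pselect (exists b, sat phi (env s b)); first by exists b.
    by exists x0 => /no.
  exists (fun k => if k is k'.+1 then F k' else w).
  move=> H clH inh HF v /=; have {}IH := IH H clH inh (fun k => HF k.+1).
  split=> [[a]|[b]].
    by rewrite IH extend_env_map => h; exists (sval a).
  pose s := [seq sval (v i) | i <- enum 'I_n].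
  have sE : (fun i : 'I_n => nth x0 s i) = fun i => sval (v i).
    apply/funext => i; rewrite (nth_map i) ?size_enum_ord //.
    by rewrite nth_ord_enum.
  have Hw : H (w s).
    apply: (HF 0) => i y; rewrite size_map size_enum_ord => ltin.
    rewrite (nth_map (Ordinal ltin)) ?size_enum_ord //; exact: svalP.
  move=> hb; exists (exist _ (w s) Hw); rewrite IH extend_env_map /=.
  by rewrite -sE; apply: wP; exists b; rewrite /env sE.
Qed.

(** The hull of the range of [g] consists of the values of finite trees with leaves in X and nodes
    labelled by codes of Skolem functions or function symbols. Trees are coded by lists over
    [nat + X], whence the bound. *)
Lemma lowenheim_skolem (M : structure V) (phi : sentence V) X (g : X -> M) :
  embeds nat X ->
  exists (H : M -> Prop) clH inh, [/\ forall x, H (g x), embeds {x | H x} X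
    & models M phi <-> models (@substructure M H clH inh) phi].
Proof.
move=> infX; have [x0] := carrier_inhabited M.
have [F FP] := skolem_functions M phi.
pose F' k (s : seq M) : M := match unpickle k : option (nat + Defs.fsym V) with
  | Some (inl k) => F k s
  | Some (inr f) => finterp M f (fun i => nth x0 s i)
  | None => x0 end.
pose val_tree := fix val_tree (t : GenTree.tree X) : M := match t with
  | GenTree.Leaf x => g x | GenTree.Node k ts => F' k (map val_tree ts) end.
pose H x := exists t, val_tree t = x.
have HF' k s : (forall i x0, i < size s -> H (nth x0 s i)) -> H (F' k s).
  move=> sH; suff [ts <-] : exists ts, map val_tree ts = s by exists (GenTree.Node k ts).
  elim: s sH => [|x s IH] sH; first by exists [::].
  have [t tx] := sH 0 x0 isT.
  have [i y|ts tss] := IH; first exact: (sH i.+1 y).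
  by exists (t :: ts); rewrite /= tx tss.
have clH : fclosed H.
  move=> f a aH; pose s := [seq a i | i <- enum 'I_(farity f)].
  have := HF' (pickle (inr f : nat + Defs.fsym V)) s; rewrite /F' pickleK.
  have -> : (fun i : 'I_(farity f) => nth x0 s i) = a.
    by apply/funext => i; rewrite (nth_map i) ?size_enum_ord // nth_ord_enum.
  apply=> i y; rewrite size_map size_enum_ord => ltin.
  by rewrite (nth_map (Ordinal ltin)) ?size_enum_ord.
have [n _] := infX.
have inh : exists x, H x by exists (val_tree (GenTree.Leaf (n 0))), (GenTree.Leaf (n 0)).
exists H, clH, inh; split.
- by move=> x; exists (GenTree.Leaf x).
- apply: (@embeds_trans (GenTree.tree X)).
    apply: (@embeds_surj _ _ (fun t => exist H (val_tree t) (ex_intro _ t erefl))).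
    by move=> [x [t tx]]; exists t; apply: sval_inj.
  apply: (@embeds_trans (seq (nat + X))).
    exists (@GenTree.encode X); exact: pcan_inj (@GenTree.codeK X).
  by apply: embeds_seq => //; apply: embeds_sum_inf => //; exact: embeds_refl.
- rewrite /models (FP H clH inh); last first.
    by move=> k s sH; have := HF' (pickle (inl k : nat + Defs.fsym V)) s sH; rewrite /F' pickleK.
  by rewrite (env0_eq (fun i => sval _) (@empty_env M)).
Qed.

End Isomorphism.

(** * Countable models of complete sentences *)

Lemma enumeration X : embeds X nat -> exists e : nat -> option X, forall x, exists n, e n = Some x.
Proof.
move=> [f fi].
have /choice[e eP] : forall n, exists o : option X, forall x, f x = n -> o = Some x.
  move=> n; have [[x <-]|no] := pselect (exists x, f x = n).
    by exists (Some x) => y /fi->.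
  by exists None => x xn; case: no; exists x.
by exists e => x; exists (f x); apply: eP.
Qed.

Lemma generic_chain C (le : C -> C -> Prop) (D : nat -> C -> Prop) (c0 : C) :
  (forall c, le c c) -> (forall b a c, le a b -> le b c -> le a c) ->
  (forall k c, exists c', le c c' /\ D k c') ->
  exists s : nat -> C, [/\ s 0 = c0, forall m n, m <= n -> le (s m) (s n)
    & forall k, D k (s k.+1)].
Proof.
move=> lexx letr dense.
have /choice[step stepP] : forall kc : nat * C, exists c', le kc.2 c' /\ D kc.1 c'.
  by move=> [k c]; exact: dense.
pose s := fix s n := if n is n'.+1 then step (n', s n') else c0.
exists s; split=> // [m n|k]; last by case: (stepP (k, s k)).
move=> /subnK <-; elim: (n - m) => [|d IH] //=.
by apply: letr IH _; case: (stepP (d + m, s (d + m))).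
Qed.

Lemma In_mem (T : eqType) (s : seq T) x : List.In x s <-> x \in s.
Proof.
elim: s => [|y s IH] //=; rewrite inE IH; split=> [[->|->]|]; rewrite ?eqxx ?orbT //.
by case/predU1P => [->|]; [left|right].
Qed.

Lemma finite_In X (s : seq X) : finite_set [set x | List.In x s]%classic.
Proof.
rewrite [Y in finite_set Y](_ : _ = [set` (s : seq {classic X})])%classic.
  exact: (@finite_seq {classic X} s).
by apply/seteqP; split=> x /=; rewrite (@In_mem {classic X}).
Qed.

Section BackAndForth.
Variables (X Y C : Type) (gr : C -> X -> Y -> Prop) (A : X -> Prop) (B : Y -> Prop).
Variables (E : nat -> C -> Prop) (c0 : C) (y0 : Y).

Let sub c c' := forall x y, gr c x y -> gr c' x y.

(** The dense requirements [E] are interleaved with the two enumerations; only the category argument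
    on stabilizers uses them, the isomorphism proofs take them trivial. [y0] is a default witness
    outside [A]. *)
Lemma back_and_forth :
  embeds X nat -> embeds Y nat ->
  (forall c x y, gr c x y -> A x /\ B y) ->
  (forall c x y x' y', gr c x y -> gr c x' y' -> (x = x' <-> y = y')) ->
  (forall c x, A x -> exists c' y, sub c c' /\ gr c' x y) ->
  (forall c y, B y -> exists c' x, sub c c' /\ gr c' x y) ->
  (forall k c, exists c', sub c c' /\ E k c') ->
  exists (s : nat -> C) (f : X -> Y),
    [/\ forall m n, m <= n -> sub (s m) (s n),
        forall n x y, gr (s n) x y -> f x = y,
        forall x, A x -> exists n, gr (s n) x (f x),
        set_bij A B f & forall k, exists n, E k (s n)].
Proof.
move=> /enumeration[eX eXP] /enumeration[eY eYP] grAB grinj forth back extra.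
pose D k c := match unpickle k : option (nat + nat + nat) with
  | Some (inl (inl n)) => forall x, eX n = Some x -> A x -> exists y, gr c x y
  | Some (inl (inr n)) => forall y, eY n = Some y -> B y -> exists x, gr c x y
  | Some (inr k) => E k c
  | None => True end.
have [||k c|s [_ smono sD]] := @generic_chain C sub D c0; rewrite /sub.
- by [].
- by move=> b a c ab bc x y /ab /bc.
- rewrite /D; case: (unpickle k) => [[[n|n]|i]|]; last by exists c.
  + case en: (eX n) => [x|]; last by exists c.
    have [Ax|nA] := pselect (A x); last by exists c; split=> // x' [<-].
    have [c' [y [cc' xy]]] := forth c x Ax; exists c'; split=> // _ [<-] _; by exists y.
  + case en: (eY n) => [x|]; last by exists c.
    have [Ax|nA] := pselect (B x); last by exists c; split=> // x' [<-].
    have [c' [y [cc' xy]]] := back c x Ax; exists c'; split=> // _ [<-] _; by exists y.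
  + exact: extra.
have cmp n m x y x' y' : gr (s n) x y -> gr (s m) x' y' -> (x = x' <-> y = y').
  move=> /(smono _ _ (leq_maxl n m)) h /(smono _ _ (leq_maxr n m)) h'; exact: grinj h h'.
have tot x : A x -> exists y n, gr (s n) x y.
  move=> Ax; have [n en] := eXP x; have := sD (pickle (inl (inl n) : nat + nat + nat)).
  by rewrite /D pickleK => /(_ x en Ax)[y h]; exists y; eexists; exact: h.
have /choice[f fP] : forall x, exists y, A x -> exists n, gr (s n) x y.
  move=> x; have [/tot[y h]|nA] := pselect (A x); first by exists y.
  by exists y0.
exists s, f; split=> //.
- move=> n x y h; have [Ax _] := grAB _ _ _ h; have [m h'] := fP x Ax.
  exact/(cmp _ _ _ _ _ _ h' h).
- split.
  + by move=> x Ax; have [n /grAB[]] := fP x Ax.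
  + move=> x x' /set_mem Ax /set_mem Ax'.
    by have [n h] := fP x Ax; have [m h'] := fP x' Ax' => /(cmp _ _ _ _ _ _ h h').
  + move=> y By; have [n en] := eYP y; have := sD (pickle (inl (inr n) : nat + nat + nat)).
    rewrite /D pickleK => /(_ y en By)[x h].
    have [Ax _] := grAB _ _ _ h; exists x => //.
    by have [m h'] := fP x Ax; apply/(cmp _ _ _ _ _ _ h' h).
- move=> k; exists (pickle (inr k : nat + nat + nat)).+1.
  by have := sD (pickle (inr k : nat + nat + nat)); rewrite /D pickleK.
Qed.

End BackAndForth.

Lemma monotone_common n (Q : 'I_n -> nat -> Prop) :
  (forall i k m, k <= m -> Q i k -> Q i m) -> (forall i, exists k, Q i k) ->
  exists k, forall i, Q i k.
Proof.
move=> Qm /choice[k kP]; exists (\max_(i < n) k i) => i; apply: Qm (kP i).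
exact: (leq_bigmax i).
Qed.

Section CompleteTheory.
Variables (V : vocabulary).

Lemma complete_equivalent (theta sigma : sentence V) (M N : structure V) :
  complete theta -> models M theta -> models N theta ->
  models M sigma <-> models N sigma.
Proof.
by move=> [_ /(_ sigma)[] h] Mt Nt; have := h _ Mt; have := h _ Nt.
Qed.

Definition same_type (X Y : structure V) n (v : 'I_n -> X) (w : 'I_n -> Y) :=
  forall phi : formula V n, sat phi v <-> sat phi w.

Lemma same_type_sym (X Y : structure V) n (v : 'I_n -> X) (w : 'I_n -> Y) :
  same_type v w -> same_type w v.
Proof. by move=> h phi; rewrite h. Qed.

(** Were every [y] refuted by a formula [chi y], the conjunction of these over an enumeration of Y
    would hold of [x], hence of some [y]. Countability of Y makes this conjunction a formula. *)
Lemma same_type_forth (X Y : structure V) n (v : 'I_n -> X) (w : 'I_n -> Y) :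
  embeds Y nat -> same_type v w ->
  forall x, exists y, same_type (extend_env x v) (extend_env y w).
Proof.
move=> /enumeration[e eP] vw x; apply: contrapT => /forallNP no.
have /choice[chi chiP] : forall y, exists phi : formula V n.+1,
    sat phi (extend_env x v) /\ ~ sat phi (extend_env y w).
  move=> y; have /existsNP[phi nphi] := no y.
  have [h|h] := pselect (sat phi (extend_env x v)).
    by exists phi; split=> // h'; apply: nphi.
  by exists (Neg phi); split=> //= h'; apply: nphi; split.
pose top : formula V n.+1 := Eq (Var V ord0) (Var V ord0).
pose all := Conj (fun k => if e k is Some y then chi y else top).
have /vw[y /=] : sat (Ex all) v.
  by exists x => k; case: (e k) => // y; case: (chiP y).
have [k ek] := eP y => /(_ k); rewrite ek; by case: (chiP y).
Qed.

(** No Scott sentence is needed: the states are pairs of tuples of equal type, and completeness says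
    that the empty tuples form one. *)
Lemma countable_models_isomorphic (theta : sentence V) (X Y : structure V) :
  complete theta -> models X theta -> models Y theta -> embeds X nat -> embeds Y nat ->
  exists h : X -> Y, isomorphism h.
Proof.
move=> cth Xt Yt cX cY; have [y0] := carrier_inhabited Y.
pose C := {n & {p : ('I_n -> X) * ('I_n -> Y) | same_type p.1 p.2}}.
pose gr (c : C) x y := exists i, (sval (tagged c)).1 i = x /\ (sval (tagged c)).2 i = y.
have c0P : same_type (@empty_env X) (@empty_env Y).
  move=> phi; exact: complete_equivalent cth Xt Yt.
pose c0 : C := Tagged (fun n => {p : ('I_n -> X) * ('I_n -> Y) | same_type p.1 p.2})
  (exist (fun p => same_type p.1 p.2) (@empty_env X, @empty_env Y) c0P).
have ext (c : C) x y :
    same_type (extend_env x (sval (tagged c)).1) (extend_env y (sval (tagged c)).2) ->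
    exists c' : C, (forall x y, gr c x y -> gr c' x y) /\ gr c' x y.
  move=> h; exists (Tagged (fun n => {p : ('I_n -> X) * ('I_n -> Y) | same_type p.1 p.2})
    (exist (fun p => same_type p.1 p.2)
      (extend_env x (sval (tagged c)).1, extend_env y (sval (tagged c)).2) h)).
  split; last by exists ord0; rewrite /= !extend_env0.
  by move=> x' y' [i [<- <-]]; exists (lift ord0 i); rewrite /= !extend_envS.
have [|||||s [f [smono sf fA [_ finj fsurj] _]]] :=
  @back_and_forth X Y C gr (fun=> True) (fun=> True) (fun _ _ => True) c0 y0 cX cY.
- by [].
- move=> [n [[v w] /= vw]] x y x' y' [i [<- <-]] [j [<- <-]] /=.
  exact: (vw (Eq (Var V i) (Var V j))).
- move=> c x _; have [y /ext[c' [cc' h]]] := same_type_forth cY (svalP (tagged c)) x.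
  by exists c', y.
- move=> c y _; have [x /same_type_sym/ext[c' [cc' h]]] :=
    same_type_forth cX (same_type_sym (svalP (tagged c))) y.
  by exists c', x.
- by move=> _ c; exists c.
(* A finite tuple and its image under [f] occur together in a single stage, whose equality of types
   then decides atomic formulas. *)
have common k (a : 'I_k -> X) : exists n (v : 'I_n -> X) (w : 'I_n -> Y) (ix : 'I_k -> 'I_n),
    [/\ same_type v w, forall i, v (ix i) = a i & forall i, w (ix i) = f (a i)].
  have [|i|m mP] := @monotone_common k (fun i m => gr (s m) (a i) (f (a i))).
  - by move=> i m m' /smono; apply.
  - exact: fA.
  have /choice[ix ixP] := mP.
  exists (tag (s m)), (sval (tagged (s m))).1, (sval (tagged (s m))).2, ix.
  by split=> [|i|i]; [exact: (svalP (tagged (s m)))|case: (ixP i)|case: (ixP i)].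
exists f; split.
- by rewrite -setTT_bijective; split.
- move=> g a; pose a' := extend_env (finterp X g a) a.
  have [n [v [w [ix [vw va wa]]]]] := common _ a'.
  have /= := vw (Eq (App (fun i => Var V (ix (lift ord0 i)))) (Var V (ix ord0))).
  rewrite va wa /a' extend_env0.
  have -> : (fun i => v (ix (lift ord0 i))) = a by apply/funext => i; rewrite va /a' extend_envS.
  have -> : (fun i => w (ix (lift ord0 i))) = fun i => f (a i).
    by apply/funext => i; rewrite wa /a' extend_envS.
  by move=> [/(_ erefl) <-].
- move=> r a; have [n [v [w [ix [vw va wa]]]]] := common _ a.
  have /= := vw (Rel (fun i => Var V (ix i))).
  have -> : (fun i => v (ix i)) = a by apply/funext => i; rewrite va.
  by have -> : (fun i => w (ix i)) = fun i => f (a i) by apply/funext => i; rewrite wa.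
Qed.


(** * A proper elementary self-embedding of the countable model *)

Section Nonmaximality.
Variables (M : structure V) (A : M -> Prop).
Hypotheses (ctM : embeds M nat) (infA : infinite_set A).
Hypothesis autA : forall g : M -> M, automorphism g -> forall x, A x -> A (g x).
Hypothesis indisc : forall s : M -> M, set_bij A A s ->
  exists2 g : M -> M, automorphism g & forall x, A x -> g x = s x.

Lemma fresh (F : set M) : finite_set F -> exists x, A x /\ ~ F x.
Proof.
move=> finF; apply: contrapT => /forallNP no; apply: infA.
apply: sub_finite_set finF => x Ax; apply: contrapT => nF; exact: (no x).
Qed.

Lemma automorphism_inv (g : M -> M) : automorphism g ->
  exists g', [/\ automorphism g', cancel g g' & cancel g' g].
Proof.
move=> /[dup] gi [[g' gK g'K] _ _]; exists g'; split=> //.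
exact: isomorphism_inv gi gK g'K.
Qed.

(* A Baire category argument: if the stabilizer of m identified no cofinite
   part of A, then for every potential image of m one could forbid, by one
   more value, that a permutation of A extends to an automorphism sending m there. *)
Lemma stabilizer_transitive n (m : 'I_n -> M) :
  exists2 F : set M, finite_set F & forall c c', A c -> A c' -> ~ F c -> ~ F c' ->
  exists g, [/\ automorphism g, forall i, g (m i) = m i & g c = c'].
Proof.
apply: contrapT => /forall2NP noF.
have [m0] := carrier_inhabited M.
pose pinj (c : seq (M * M)) := (forall x y, List.In (x, y) c -> A x /\ A y) /\
  forall x y x' y', List.In (x, y) c -> List.In (x', y') c -> (x = x' <-> y = y').
pose C := {c | pinj c}; pose gr (c : C) x y := List.In (x, y) (sval c).
have add (c : C) x y : A x -> A y -> (forall z, ~ gr c x z) -> (forall z, ~ gr c z y) ->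
    exists c' : C, (forall x y, gr c x y -> gr c' x y) /\ gr c' x y.
  move=> Ax Ay nx ny; have [/= h1 h2] := svalP c.
  have h : pinj ((x, y) :: sval c).
    split=> [x' y' /= [[<- <-]//|/h1//]|a b a' b' /= [[<- <-]|h] [[<- <-]|h']] //.
    - by split=> e; [case: (nx b'); rewrite /gr e|case: (ny a'); rewrite /gr e].
    - by split=> e; [case: (nx b); rewrite /gr -e|case: (ny a); rewrite /gr -e].
    - exact: h2 h h'.
  by exists (exist _ _ h); split; [right|left].
have c0P : pinj [::] by split.
have /enumeration[e eP] : embeds ('I_n -> M) nat.
  apply: (@embeds_trans (seq M)); last exact: embeds_seq (embeds_refl nat) ctM.
  exists (fun v => [seq v i | i <- enum 'I_n]) => v w /eq_in_map h.
  by apply/funext => i; apply: h; rewrite mem_enum.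
(* The condition [c], a finite partial injection of [A], rules out the k-th tuple as image of
   [m]. *)
pose E k (c : C) := forall m', e k = Some m' -> ~ exists g, [/\ automorphism g,
  forall x y, gr c x y -> g x = y & forall i, g (m i) = m' i].
have in1 (c : seq (M * M)) x y : List.In (x, y) c -> List.In x [seq p.1 | p <- c].
  by move=> h; apply: (List.in_map fst c (x, y)).
have in2 (c : seq (M * M)) x y : List.In (x, y) c -> List.In y [seq p.2 | p <- c].
  by move=> h; apply: (List.in_map snd c (x, y)).
have [|||||s [f [smono sf _ fb fE]]] :=
  @back_and_forth M M C gr A A E (exist _ _ c0P) m0 ctM ctM.
- by move=> c; case: (svalP c).
- by move=> c; case: (svalP c).
- move=> c x Ax; have [[y xy]|no] := pselect (exists y, gr c x y); first by exists c, y.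
  have [y [Ay ny]] := fresh (finite_In [seq p.2 | p <- sval c]).
  have [|z h|c' [cc' h]] := add c x y Ax Ay; last by exists c', y.
    by move=> z h; apply: no; exists z.
  by apply: ny; apply: in2 h.
- move=> c y Ay; have [[x xy]|no] := pselect (exists x, gr c x y); first by exists c, x.
  have [x [Ax nx]] := fresh (finite_In [seq p.1 | p <- sval c]).
  have [z h||c' [cc' h]] := add c x y Ax Ay; last by exists c', x.
    by apply: nx; apply: in1 h.
  by move=> z h; apply: no; exists z.
- move=> k c; have [Ec|nE] := pselect (E k c); first by exists c.
  have /existsNP[m' /not_implyP[em' /contrapT[g [ag gc gm]]]] := nE.
  have [/(_ (finite_In _))//|/existsNP[a /existsNP[b nab]]] :=
    noF [set x | List.In x [seq p.1 | p <- sval c]]%classic.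
  move: nab => /not_implyP[Aa /not_implyP[Ab /not_implyP[na /not_implyP[nb nab]]]].
  have [g' [ag' gK g'K]] := automorphism_inv ag.
  have nA x : A x -> ~ List.In x [seq p.1 | p <- sval c] ->
    forall z, ~ gr c z (g x).
    move=> Ax nx z h; have /(can_inj gK) e' := gc _ _ h; apply: nx; rewrite -e'.
    exact: in1 h.
  (* Here [g] extends [c] and sends [m] to [m']. Adding the pair [(a, g b)] excludes [m']: for any
     [g1] meeting it, the composite [g' \o g1] would fix [m] and send [a] to [b], against the choice
     of [a] and [b]. *)
  have [z h||c' [cc' h]] := add c a (g b) Aa (autA ag Ab).
  + by apply: na; apply: in1 h.
  + by move=> z h; apply: nA Ab nb z h.
  exists c'; split=> // m1; rewrite em' => -[<-] [g1 [ag1 g1c g1m]]; apply: nab.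
  exists (g' \o g1); split.
  + exact: isomorphism_comp ag1 ag'.
  + by move=> i /=; rewrite g1m -gm gK.
  + by rewrite /= (g1c _ _ h) gK.
have [g ag gf] := indisc fb.
have [k ek] := eP (fun i => g (m i)); have [j /(_ _ ek)] := fE k; apply.
exists g; split=> // x y h; rewrite -(sf _ _ _ h) gf //.
by case: (svalP (s j)) => /(_ _ _ h)[].
Qed.

(** [j] is a pointwise limit of automorphisms; each one agrees with all later ones on [e 0], ...,
    [e n], so on a finite tuple [j] coincides with an automorphism. The preimage of [c0] under the
    n-th automorphism is kept outside [e 0], ..., [e n]; it escapes in the limit, and [j] omits
    [c0]. *)
Lemma nonsurjective_elementary : exists j : M -> M, elementary j /\ exists b, forall a, j a <> b.
Proof.
have [x0] := carrier_inhabited M.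
have /enumeration[e' e'P] := ctM; pose e n := odflt x0 (e' n).
have /choice[idx idxP] : forall x, exists n, e n = x.
  by move=> x; have [n en] := e'P x; exists n; rewrite /e en.
have /choice[F FP] : forall n, exists F : set M, finite_set F /\ forall c c',
    A c -> A c' -> ~ F c -> ~ F c' ->
    exists g, [/\ automorphism g, forall i, i <= n -> g (e i) = e i & g c = c'].
  move=> n; have [F finF FP] := stabilizer_transitive (fun i : 'I_n.+1 => e i).
  exists F; split=> // c c' Ac Ac' Fc Fc'; have [g [ag gm gc]] := FP c c' Ac Ac' Fc Fc'.
  by exists g; split=> // i le; have := gm (Ordinal (le : i < n.+1)).
have freshn n G : finite_set G ->
    exists c, [/\ A c, ~ G c, ~ F n c & forall i, i <= n -> c <> e i].
  move=> finG; have fine : finite_set (e @` [set i | i < n.+1])%classic.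
    by apply: finite_image; exact: finite_II.
  have [|c [Ac nc]] := fresh (F := G `|` (F n `|` e @` [set i | i < n.+1]))%classic.
    by rewrite !finite_setU; split=> //; split=> //; case: (FP n).
  exists c; split=> // [h|h|i le ci]; apply: nc; [by left|by right; left|].
  by right; right; exists i.
pose good n (p : (M -> M) * M) := [/\ automorphism p.1, A p.2, ~ F n p.2 &
  forall i, i <= n -> p.2 <> e i].
have [c0 [Ac0 _ Fc0 ec0]] := freshn 0 set0 (finite_set0 _).
have /choice[step stepP] : forall np : nat * ((M -> M) * M), exists q,
    good np.1 np.2 -> [/\ good np.1.+1 q, q.1 q.2 = np.2.1 np.2.2 &
      forall i, i <= np.1 -> q.1 (e i) = np.2.1 (e i)].
  move=> [n [g c]]; have [/= gd|/= ngd] := pselect (good n (g, c)); last by exists (g, c).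
  (* [c'] avoids [F n], so that an automorphism fixing [e 0], ..., [e n] carries it to [c], and
     [F n.+1], so that the next step is possible. *)
  have [c' [Ac' Fc' Fc'' ec']] := freshn n.+1 _ (proj1 (FP n)).
  have [/= ag Ac Fc ec] := gd.
  have [h [ah hm hc]] := (proj2 (FP n)) c' c Ac' Ac Fc' Fc.
  exists (g \o h, c') => _; split=> /=; last by move=> i le; rewrite hm.
    by split=> //=; exact: isomorphism_comp ah ag.
  by rewrite hc.
pose s := fix s n := if n is n'.+1 then step (n', s n') else (id, c0).
have sgood n : good n (s n).
  elim: n => [|n IH] /=; last by case: (stepP (n, s n) IH).
  by split=> //=; split=> //; exists id.
have sc n : (s n).1 (s n).2 = c0.
  by elim: n => [|n IH] //=; case: (stepP (n, s n) (sgood n)) => _ /= ->.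
have se n i : i <= n -> (s n).1 (e i) = (s i).1 (e i).
  move=> /subnK <-; elim: (n - i) => [|d IH] //; rewrite addSn /=.
  have [_ _ /= ->] := stepP (d + i, s (d + i)) (sgood _); first exact: IH.
  exact: leq_addl.
pose j x := (s (idx x)).1 x.
have jE n x : idx x <= n -> j x = (s n).1 x.
  by move=> le; rewrite /j -{2}(idxP x) -(se _ _ le) idxP.
exists j; split.
  move=> n phi v; pose N := \max_(i < n) idx (v i).
  have -> : (fun i => j (v i)) = fun i => (s N).1 (v i).
    by apply/funext => i; apply: jE; apply: (leq_bigmax i).
  by apply: isomorphism_elementary; case: (sgood N).
exists c0 => x; rewrite /j => e0; have [[[g' gK _] _ _] _ _ nx] := sgood (idx x).
apply: (nx (idx x) (leqnn _)); rewrite idxP; apply: (can_inj gK).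
by rewrite sc e0.
Qed.

End Nonmaximality.

Lemma maximal_uncountable (theta : sentence V) (P : rsym V) (M N : structure V) :
  complete theta -> models M theta -> embeds M nat -> absolute_indiscernibles M P ->
  models N theta -> is_maximal N -> ~ embeds N nat.
Proof.
move=> cth Mt cM [infP indisc] Nt maxN cN.
have [|j [je [b jb]]] := nonsurjective_elementary cM infP _ indisc.
  by move=> g [_ _ gr] x /(gr P (fun=> x)).
have [h hi] := countable_models_isomorphic cth Nt Mt cN cM.
apply: maxN; exists M, (j \o h); split; last by exists b => a; exact: jb.
exact: elementary_comp (isomorphism_elementary hi) je.
Qed.

(** Conjugating [f] by isomorphisms with M turns it into a permutation of the indiscernibles of M,
    which extends to an automorphism. *)
Lemma countable_extension (theta : sentence V) (P : rsym V) (M X Y : structure V) (f : X -> Y) :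
  complete theta -> models M theta -> embeds M nat -> absolute_indiscernibles M P ->
  models X theta -> models Y theta -> embeds X nat -> embeds Y nat ->
  set_bij (Defs.pred_set X P) (Defs.pred_set Y P) f ->
  exists2 h : X -> Y, isomorphism h & forall x, Defs.pred_set X P x -> h x = f x.
Proof.
move=> cth Mt cM [infP indisc] Xt Yt cX cY [fP finj fsurj].
have [h0 ih0] := countable_models_isomorphic cth Xt Mt cX cM.
have [k ik] := countable_models_isomorphic cth Yt Mt cY cM.
have [[h0' h0K h0K'] _ rh0] := ih0; have [[k' kK kK'] _ rk] := ik.
have ph0 x : Defs.pred_set X P x <-> Defs.pred_set M P (h0 x) := rh0 P _.
have pk x : Defs.pred_set Y P x <-> Defs.pred_set M P (k x) := rk P _.
have [|g ag gE] := indisc (k \o f \o h0').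
  split.
  - by move=> x Px /=; apply/pk/fP/ph0; rewrite h0K'.
  - move=> x y /set_mem Px /set_mem Py /= /(can_inj kK) /finj e.
    apply: (can_inj h0K'); apply: e; apply: mem_set; apply/ph0; by rewrite h0K'.
  - move=> y Py; have [|x Px xy] := fsurj (k' y); first by apply/pk; rewrite kK'.
    by exists (h0 x); [apply/ph0|rewrite /= h0K xy kK'].
exists (k' \o g \o h0); last by move=> x /ph0 Px /=; rewrite gE //= h0K kK.
apply: isomorphism_comp ih0 _; apply: isomorphism_comp ag _.
exact: isomorphism_inv ik kK kK'.
Qed.

End CompleteTheory.

(** * A regressive action on an order whose initial segments are small *)

Lemma surj_of_embeds X Y (y0 : Y) : embeds Y X -> exists f : X -> Y, forall y, exists x, f x = y.
Proof.
move=> [h hi].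
have /choice[f fP] : forall x, exists y, forall y', h y' = x -> y' = y.
  move=> x; have [[y <-]|no] := pselect (exists y, h y = x).
    by exists y => y' /hi.
  by exists y0 => y' e; case: no; exists y'.
by exists f => y; exists (h y); rewrite -(fP (h y) y).
Qed.

Lemma finite_set_vector X (S : set X) : finite_set S ->
  exists k (c : 'I_k -> X), forall y, S y <-> exists i, c i = y.
Proof.
move=> /(@finite_seqP {classic X})[s ->].
exists (size s), (tnth (in_tuple s)) => y; split=> /=.
  by move=> /(tnthP (in_tuple s))[i ->]; exists i.
by move=> [i <-]; exact: mem_tnth.
Qed.

Lemma finite_range k X (c : 'I_k -> X) : finite_set [set y | exists i, c i = y]%classic.
Proof.
rewrite [X in finite_set X](_ : _ = (c @` setT)%classic).
  exact/finite_image/finite_finset.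
by apply/seteqP; split=> y /= [i]; [exists i|move=> _ <-; exists i].
Qed.

(* In [full_point], a value [b i] that is not below [x] stands for [y] itself. *)
Record full (D L : Type) (lt : L -> L -> Prop) (g : L -> D -> L) : Prop := Full {
  full_irr : forall x, ~ lt x x;
  full_trans : forall x y z, lt x y -> lt y z -> lt x z;
  full_weak : forall x y z, lt x z -> lt x y \/ lt y z;
  full_dense : forall x y, lt x y -> exists z, lt x z /\ lt z y;
  full_above : forall x, exists y, lt x y;
  full_below : forall x, exists y, lt y x;
  full_reg : forall x u, g x u = x \/ lt (g x u) x;
  full_row : forall m (a b : 'I_m -> L) k (c : 'I_k -> D), injective a ->
    (forall i, b i = a i \/ lt (b i) (a i)) ->
    exists u, (forall j, c j <> u) /\ forall i, g (a i) u = b i;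
  full_point : forall m (p : 'I_m -> D) (b : 'I_m -> L) k (c : 'I_k -> L) x, injective p ->
    exists y, [/\ ~ lt x y, ~ lt y x, forall j, c j <> y
      & forall i, (lt (b i) x -> g y (p i) = b i) /\ (~ lt (b i) x -> g y (p i) = y)];
  full_finite : forall m (p : 'I_m -> D) x, exists k (c : 'I_k -> L),
    (exists i, c i = x) /\ forall i j, exists l, g (c i) (p j) = c l }.

Lemma ohead_filterP X (P : pred X) (s : seq X) :
  match ohead (filter P s) with
  | Some x => List.In x s /\ P x
  | None => forall x, List.In x s -> ~~ P x end.
Proof.
elim: s => [|x s IH] //=; case Px: (P x) => /=; first by split=> //; left.
case: (ohead _) IH => [y [? ?]|IH]; first by split=> //; right.
by move=> y [<-|/IH//]; rewrite Px.
Qed.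

(** * The action of D on a set of size |D|^+ *)

Section Construction.
Variables (D Dp : Type) (R : Dp -> Dp -> Prop).
Hypotheses (infD : embeds nat D) (wfR : well_founded R).
Hypothesis triR : forall x y, R x y \/ x = y \/ R y x.
Hypothesis smallR : forall s, embeds {t | R t s} D.
Variable S : Dp -> D -> bool.
Hypothesis S_inj : injective S.

(** One copy of the rationals, called a block, for each element of the well-order: the rationals
    give density and remove endpoints, the well-order gives small segments and a rank for
    recursions. *)
Definition level := (Dp * rat)%type.
Definition point := (level * (nat * D))%type.

Definition level_lt (l l' : level) := R l.1 l'.1 \/ l.1 = l'.1 /\ (l.2 < l'.2)%R.
Definition point_lt (x y : point) := level_lt x.1 y.1.

Lemma level_lt_irr l : ~ level_lt l l.
Proof. by move=> [/(wo_irr wfR)//|[_]]; rewrite Order.POrderTheory.ltxx. Qed.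

Lemma level_lt_trans l1 l2 l3 : level_lt l1 l2 -> level_lt l2 l3 -> level_lt l1 l3.
Proof.
case: l1 l2 l3 => [a p] [b q] [c r] [/= ab|[/= -> pq]] [/= bc|[/= <- qr]].
- by left; apply: wo_trans ab bc.
- by left.
- by left.
- by right; split=> //; exact: Order.POrderTheory.lt_trans pq qr.
Qed.

Lemma level_lt_weak l1 l2 l3 : level_lt l1 l3 -> level_lt l1 l2 \/ level_lt l2 l3.
Proof.
case: l1 l2 l3 => [a p] [b q] [c r] h.
have [ab|[e|ba]] := triR a b; first by left; left.
  subst b; have [pq|qp] := Order.TotalTheory.ltP p q; first by left; right.
  right; case: h => /= [ac|[/= <- pr]]; first by left.
  by right; split=> //; exact: Order.POrderTheory.le_lt_trans qp pr.
right; left=> /=; case: h => /= [ac|[<- _] //]; exact: wo_trans ba ac.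
Qed.

Lemma segment_small (l : level) : embeds {y : point | level_lt y.1 l} D.
Proof.
have key x : x = l.1 \/ R x l.1 -> exists o : option {t | R t l.1},
    if o is Some t then sval t = x else x = l.1.
  by move=> [->|xm]; [exists None|exists (Some (exist _ x xm))].
have /choice[f fP] : forall x, exists o : option {t | R t l.1}, x = l.1 \/ R x l.1 ->
    if o is Some t then sval t = x else x = l.1.
  move=> x; have [/key[o oP]|n] := pselect (x = l.1 \/ R x l.1); first by exists o.
  by exists None.
apply: (@embeds_trans (option {t | R t l.1} * (rat * (nat * D)))).
  exists (fun y => (f (sval y).1.1, ((sval y).1.2, (sval y).2))).
  move=> [[[a q] z] /= h] [[[a' q'] z'] /= h'] [e eq ez]; apply: sval_inj => /=.
  rewrite {}eq {}ez.
  have /fP ha : a = l.1 \/ R a l.1 by case: h => /= [|[]]; tauto.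
  have /fP ha' : a' = l.1 \/ R a' l.1 by case: h' => /= [|[]]; tauto.
  suff -> : a = a' by [].
  by move: ha ha'; rewrite e; case: (f a') => [t <- <-|-> ->].
have natD := embeds_refl D.
apply: embeds_prod_inf => //.
  apply: embeds_trans (embeds_option infD).
  have [h hi] := smallR l.1; exists (omap h) => -[x|] [y|] //= [/hi->] //.
apply: embeds_prod_inf => //.
  have /card_esym := card_rat; move/card_eqPle => [_ /embedsP h].
  exact: embeds_trans h infD.
exact: embeds_prod_inf.
Qed.

Lemma level_lt_dense l l' : level_lt l l' -> exists l'', level_lt l l'' /\ level_lt l'' l'.
Proof.
case: l l' => [a p] [b q] [/= ab|[/= <- pq]].
  exists (a, p + 1)%R; split; last by left.
  by right; split=> //=; rewrite Num.Theory.ltrDl.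
exists (a, (p + q) / 2%:R)%R.
by have [h1 h2] := Num.Theory.midf_lt pq; split; right.
Qed.

Lemma level_lt_above l : exists l', level_lt l l'.
Proof. by exists (l.1, l.2 + 1)%R; right; rewrite Num.Theory.ltrDl. Qed.

Lemma level_lt_below l : exists l', level_lt l' l.
Proof.
by exists (l.1, l.2 - 1)%R; right; rewrite Num.Theory.ltrBlDr Num.Theory.ltrDl.
Qed.

(* Let x = (alpha, q, n, k). The list [du u] makes u act on finitely many points
   per block alpha: an entry names a point by its code within the block and by
   finitely many bits of [S alpha], as in the Hewitt-Marczewski-Pondiczery
   theorem, so that finite patterns over |D|^+ points are realized by |D| many u.
   The list [dk k] prescribes g x at finitely many u, but only values that decrease
   (alpha, n) lexicographically are obeyed. The orders on alpha and n being
   well-founded, finitely many u's generate finite sets, although the order on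
   levels is dense. *)
Lemma point_full : exists g : point -> D -> point, full point_lt g.
Proof.
have [nD nDi] := infD; pose d0 := nD 0.
have natD := embeds_refl D.
(* [e l] lists by D all points strictly below level [l], so that elements of D can name every
   possible value of g other than the point itself. *)
have /choice[e eP] : forall l : level, exists f : D -> point,
    (forall v, level_lt (f v).1 l) /\ forall y, level_lt y.1 l -> exists v, f v = y.
  move=> l; have [l' l'l] := level_lt_below l.
  have [f fP] := surj_of_embeds (exist (fun y : point => level_lt y.1 l) (l', (0, d0)) l'l)
    (segment_small l).
  exists (fun v => sval (f v)); split; first by move=> v; exact: (svalP (f v)).
  by move=> y yl; have [v vE] := fP (exist _ y yl); exists v; rewrite vE.
have ratD : embeds rat D.
  have /card_esym := card_rat; move/card_eqPle => [_ /embedsP h].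
  exact: embeds_trans h infD.
have [code0 code0_inj] : embeds (rat * (nat * D)) D.
  by do 2!apply: embeds_prod_inf => //.
pose code (x : point) := code0 (x.1.2, x.2).
have [dk dkP] : exists f : D -> seq (D * option D), forall s, exists k, f k = s.
  apply: (surj_of_embeds [::]); apply: embeds_seq => //.
  by apply: embeds_prod_inf => //; exact: embeds_option.
pose entry := (seq (D * bool) * (D * D))%type.
(* The extra natural number gives every list of entries infinitely many codes [u]; [full_row] needs
   one outside a finite set. *)
have [du duP] : exists f : D -> nat * seq entry, forall s, exists k, f k = s.
  apply: (surj_of_embeds (0, [::])); apply: embeds_prod_inf => //.
  apply: embeds_seq => //; apply: embeds_prod_inf => //; last exact: embeds_square.
  apply: embeds_seq => //; apply: embeds_prod_inf => //.
  by apply: embeds_trans infD; exists nat_of_bool; case; case.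
(* [None]: the list of [k] is silent on [u]. [Some None]: it makes [u] fix the point.
   [Some (Some v)]: it proposes the value named by [v]. *)
pose key k u := omap snd (ohead (filter (fun w : D * option D => `[< w.1 = u >]) (dk k))).
pose fits (x : point) (w : entry) :=
  `[< (forall b, List.In b w.1 -> S x.1.1 b.1 = b.2) /\ w.2.1 = code x >].
pose look x u := ohead (filter (fits x) (du u).2).
pose lower (y x : point) := R y.1.1 x.1.1 \/ y.1.1 = x.1.1 /\ y.2.1 < x.2.1.
(* The point's own list takes precedence, so that [full_point] holds whatever the given u do; for
   [full_row] one picks a [u] on which the finitely many points are silent. *)
pose g (x : point) u : point := match key x.2.2 u with
  | Some (Some v) => if `[< lower (e x.1 v) x >] then e x.1 v else x
  | Some None => x
  | None => if look x u is Some w then e x.1 w.2.2 else x end.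
have g_reg x u : g x u = x \/ point_lt (g x u) x.
  rewrite /g /point_lt; case: (key _ _) => [[v|]|]; [|by left|].
    by case: asboolP; [right; case: (eP x.1)|left].
  by case: (look _ _); [right; case: (eP x.1)|left].
have g_cases x u : g x u = x \/ lower (g x u) x \/ look x u <> None.
  rewrite /g; case: (key _ _) => [[v|]|]; [|by left|].
    by case: asboolP; [right; left|left].
  by case: (look _ _) => [w|]; [right; right|left].
exists g; split.
- by move=> x; exact: level_lt_irr.
- by move=> x y z; exact: level_lt_trans.
- by move=> x y z; exact: level_lt_weak.
- by move=> x y /level_lt_dense[l h]; exists (l, x.2).
- by move=> x; have [l h] := level_lt_above x.1; exists (l, x.2).
- by move=> x; have [l h] := level_lt_below x.1; exists (l, x.2).
- exact: g_reg.
- move=> m a b k c ainj ab.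
  have /choice[v vP] : forall i, exists v, point_lt (b i) (a i) -> e (a i).1 v = b i.
    move=> i; have [h|n] := pselect (point_lt (b i) (a i)); last by exists d0.
    by have [_ /(_ _ h)[v vE]] := eP (a i).1; exists v.
  (* Distinct blocks differ in some bit. With these finitely many bits, the entry [w i] fits [a i]
     and no other [a j]. *)
  have /choice[sep sepP] : forall ij : 'I_m * 'I_m, exists d, (a ij.1).1.1 <> (a ij.2).1.1 ->
      S (a ij.1).1.1 d <> S (a ij.2).1.1 d.
    move=> [i j] /=; have [->|ne] := pselect ((a i).1.1 = (a j).1.1); first by exists d0.
    apply: contrapT => /forallNP no; apply: ne; apply: S_inj; apply/funext => d.
    by have /not_implyP[_ /contrapT] := no d.
  pose sel i := [seq (sep (i, j), S (a i).1.1 (sep (i, j))) | j <- enum 'I_m].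
  pose w i : entry := (sel i, (code (a i), v i)).
  pose ws := [seq w i | i <- enum 'I_m & `[< point_lt (b i) (a i) >]].
  have wsP x : List.In x ws <-> exists i, point_lt (b i) (a i) /\ x = w i.
    rewrite List.in_map_iff; split=> [[i [<-]]|[i [h ->]]].
      by rewrite In_mem mem_filter => /andP[/asboolP h _]; exists i.
    by exists i; rewrite In_mem mem_filter mem_enum andbT; split=> //; exact/asboolP.
  have fitsw i j : fits (a j) (w i) <-> i = j.
    split=> [/asboolP[/= h ci]|->]; last first.
      by apply/asboolP; split=> // d /List.in_map_iff[j' [<-]].
    apply: ainj; move: h ci; have [e1 _ /code0_inj|ne h _] := pselect ((a i).1.1 = (a j).1.1).
      by move: e1; case: (a i) (a j) => [[? ?] ?] [[? ?] ?] /= -> [-> ->].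
    case: (sepP (i, j) ne); rewrite (h (sep (i, j), S (a i).1.1 (sep (i, j)))) //.
    by apply/List.in_map_iff; exists j; split=> //; rewrite In_mem mem_enum.
  have /choice[un unP] : forall n, exists u, du u = (n, ws) by move=> n; exact: duP.
  pose bad := ([set u | exists j, c j = u] `|`
    \bigcup_(j in [set: 'I_m]) [set u | key (a j).2.2 u <> None])%classic.
  have fbad : finite_set bad.
    rewrite finite_setU; split; first exact: finite_range.
    apply: bigcup_finite => [|j _]; first exact: finite_finset.
    apply: sub_finite_set (finite_In [seq w.1 | w <- dk (a j).2.2]) => u /=.
    rewrite /key; have := ohead_filterP (fun w : D * option D => `[< w.1 = u >]) (dk (a j).2.2).
    by case: (ohead _) => [z [h /asboolP <-] _|//]; apply: List.in_map.
  have [n nbad] : exists n, ~ bad (un n).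
    apply: contrapT => /forallNP h; apply: infinite_nat.
    apply: sub_finite_set (finite_preimage (f := un) _ fbad) => [n _|n n' _ _ e'] /=.
      by have /contrapT := h n.
    by have := unP n; rewrite e' unP => -[].
  exists (un n); split; first by move=> j cj; apply: nbad; left; exists j.
  move=> j; rewrite /g; case kj: (key _ _) => [o|].
    by case: nbad; right; exists j => //=; rewrite kj.
  rewrite /look unP /=; have := ohead_filterP (fits (a j)) ws.
  case: (ohead _) => [z [/wsP[i [h ->]] /fitsw ij]|no]; first by subst j; rewrite /= vP.
  have [//|h] := ab j; have /no/negP[] : List.In (w j) ws by apply/wsP; exists j.
  exact/fitsw.
- move=> m p b k c x pinj.
  have /choice[v vP] : forall i, exists v, point_lt (b i) x -> e x.1 v = b i.
    move=> i; have [h|n] := pselect (point_lt (b i) x); last by exists d0.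
    by have [_ /(_ _ h)[v vE]] := eP x.1; exists v.
  pose o i := if `[< point_lt (b i) x >] then Some (v i) else None.
  have [kx kxP] := dkP [seq (p i, o i) | i <- enum 'I_m].
  (* [N] exceeds the third coordinates of all [b i] and [c j]: a value [b i] in the block of [y]
     then counts as decreasing and is obeyed, and [y] differs from every [c j]. *)
  pose N := (\max_i (b i).2.1 + \max_j (c j).2.1).+1.
  pose y : point := (x.1, (N, kx)); exists y.
  split; [exact: level_lt_irr|exact: level_lt_irr| |].
    move=> j cj; have := leq_bigmax (F := fun j => (c j).2.1) j.
    by rewrite cj /= /N leqNgt ltnS leq_addl.
  move=> i; have keyi : key kx (p i) = Some (o i).
    rewrite /key kxP; set s := map _ _.
    have := ohead_filterP (fun w : D * option D => `[< w.1 = p i >]) s.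
    case: (ohead _) => [z [/List.in_map_iff[i' [<- _]] /asboolP /= /pinj -> //]|no].
    have /no/negP[] : List.In (p i, o i) s.
      by apply/List.in_map_iff; exists i; split=> //; rewrite In_mem mem_enum.
    exact/asboolP.
  rewrite /g keyi /o; case: asboolP => h; split=> // _.
  rewrite vP //; case: asboolP => // -[]; case: h => [h|[h _]]; [by left|right].
  split=> //=; have := leq_bigmax (F := fun i => (b i).2.1) i.
  by rewrite /N ltnS => /leq_trans; apply; exact: leq_addr.
- move=> m p x.
  suff [T [finT Tx Tcl]] : exists T : set point, [/\ finite_set T, T x &
      forall y i, T y -> T (g y (p i))].
    have [k [c cP]] := finite_set_vector finT; exists k, c; split; first exact/cP.
    move=> i j; have /Tcl h : T (c i) by apply/cP; exists i.
    by have /cP[l] := h j; exists l.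
  move: x; suff main al : forall x : point, x.1.1 = al -> exists T : set point,
    [/\ finite_set T, T x & forall y i, T y -> T (g y (p i))] by move=> x; exact: main.
  elim: al / (wfR al) => al _ IHal.
  (* outside [exc], g x u is x, or in a lower block, or has a smaller third coordinate *)
  pose exc := [set y : point | y.1.1 = al /\ exists i, look y (p i) <> None]%classic.
  have fexc : finite_set exc.
    pose zs := (\bigcup_(i in [set: 'I_m])
      [set z | List.In z [seq w.2.1 | w <- (du (p i)).2]])%classic.
    have fzs : finite_set zs.
      by apply: bigcup_finite => [|i _]; [exact: finite_finset|exact: finite_In].
    apply: (sub_finite_set (B := (exc `&` (code @^-1` zs))%classic)).
      move=> y [yal [i li]]; split; first by split=> //; exists i.
      exists i => //=; move: li; rewrite /look.
      have := ohead_filterP (fits y) (du (p i)).2.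
      case: (ohead _) => [w [h /asboolP[_ <-]] _|//].
      by apply: (List.in_map (fun w : entry => w.2.1)).
    have h : finite_set ((fun y => (y.1.1, code y)) @^-1` ([set al] `*` zs))%classic.
      apply: finite_preimage; last by apply: finite_setX => //; exact: finite_set1.
      move=> [[a q] z] [[a' q'] z'] _ _ [-> /code0_inj[-> ez]]; by rewrite ez.
    by apply: sub_finite_set h => y [[yal _] yz]; split.
  pose tgt := (\bigcup_(i in [set: 'I_m]) ((fun y => g y (p i)) @` exc))%classic.
  have ftgt : finite_set tgt.
    by apply: bigcup_finite => [|i _]; [exact: finite_finset|exact: finite_image].
  (* Exceptional values may stay in the block without decreasing, so the recursion does not follow
     them. They are tolerated as members of the finite set [tgt], whose members are closed off
     together at the end. *)
  pose quasi (T : set point) := finite_set T /\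
    forall y i, T y -> T (g y (p i)) \/ tgt (g y (p i)).
  have below (y : point) : R y.1.1 al -> exists T, quasi T /\ T y.
    move=> /IHal/(_ y erefl)[T [fT Ty cT]]; exists T; do 2!split=> //.
    by move=> z i /cT; left.
  have block n : forall y : point, y.1.1 = al -> y.2.1 = n -> exists T, quasi T /\ T y.
    elim/ltn_ind: n => n IHn y yal yn.
    have /choice[T TP] : forall i, exists T, quasi T /\
        (g y (p i) = y \/ T (g y (p i)) \/ tgt (g y (p i))).
      have q0 : quasi set0 by split.
      move=> i; have [h|[[h|[h1 h2]]|h]] := g_cases y (p i).
      - by exists set0; split=> //; left.
      - by have [|T [qT Ty]] := below (g y (p i)); [rewrite -yal|exists T; split=> //; right; left].
      - have [|||T [qT Ty]] := IHn (g y (p i)).2.1 _ (g y (p i)); rewrite -?yn -?yal //.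
        by exists T; split=> //; right; left.
      - exists set0; split=> //; do 2!right; exists i => //; exists y => //.
        by split=> //; exists i.
    exists ([set y] `|` \bigcup_(i in [set: 'I_m]) T i)%classic; split; last by left.
    split.
      rewrite finite_setU; split; first exact: finite_set1.
      by apply: bigcup_finite => [|i _]; [exact: finite_finset|case: (TP i) => -[]].
    move=> z i [->|[j _ Tz]].
      have [_ [->|[h|h]]] := TP i; [by left; left|by left; right; exists i|by right].
    have [[_ /(_ z i Tz)[h|h]] _] := TP j; [by left; right; exists j|by right].
  move=> x xal; have [T0 [[fT0 cT0] T0x]] := block _ x xal erefl.
  have /choice[T TP] : forall t, exists T, quasi T /\ (tgt t -> T t).
    move=> t; have [[i _ [y [yal _] ty]]|n] := pselect (tgt t); last first.
      by exists set0; split=> //; split.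
    have [e'|[e'|ba]] := triR t.1.1 al.
    - by have [T [? ?]] := below t e'; exists T.
    - by have [T [? ?]] := block _ t e' erefl; exists T.
    (* By regressivity no member of [tgt] lies in a block after [al]. *)
    have := g_reg y (p i); rewrite ty => -[e'|[h|[h _]]].
    - by move: ba; rewrite e' yal => /(wo_irr wfR).
    - by move: h; rewrite yal => /(wo_asym wfR ba).
    - by move: ba; rewrite h yal => /(wo_irr wfR).
  exists (T0 `|` \bigcup_(t in tgt) T t)%classic; split.
  - rewrite finite_setU; split=> //.
    by apply: bigcup_finite => // t _; case: (TP t) => -[].
  - by left.
  have in_tgt z : tgt z -> (T0 `|` \bigcup_(t in tgt) T t)%classic z.
    by move=> tz; right; exists z => //; case: (TP z) => _; apply.
  move=> y i [T0y|[t tt Ty]].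
    by have [h|/in_tgt//] := cT0 y i T0y; left.
  have [[_ /(_ y i Ty)[h|/in_tgt//]] _] := TP t.
  by right; exists t.
Qed.

Lemma embeds_point : embeds nat Dp -> embeds D Dp -> embeds point Dp.
Proof.
move=> infDp DDp; apply: embeds_prod_inf => //; apply: embeds_prod_inf => //.
- exact: embeds_refl.
- have /card_esym := card_rat; move/card_eqPle => [_ /embedsP h].
  exact: embeds_trans h infDp.
Qed.

End Construction.

Theorem full_exists D Dp : embeds nat D -> is_card_succ D Dp ->
  exists (L : Type) (lt : L -> L -> Prop) (g : L -> D -> L),
    [/\ full lt g, embeds L Dp & embeds Dp L].
Proof.
move=> infD sD; have [R [wfR triR smallR]] := card_succ_wo sD.
have [S Sinj] := card_succ_bits sD.
have [g gP] := point_full infD wfR triR smallR Sinj.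
exists (point D Dp), (@point_lt D Dp R), g; split=> //.
  apply: embeds_point; last exact: card_succ_embeds.
  exact: embeds_trans infD (card_succ_embeds sD).
have [n _] := infD; exists (fun a => ((a, 0%R), (0, n 0))) => a b [->] //.
Qed.

(** * Definability and the axioms of psi *)

Definition vec2 X (x y : X) : 'I_2 -> X := fun i => if val i is 0 then x else y.
Definition vec3 X (x y z : X) : 'I_3 -> X :=
  fun i => match val i with 0 => x | 1 => y | _ => z end.

Lemma vec2_eta X (a : 'I_2 -> X) : a = vec2 (a (@Ordinal 2 0 isT)) (a (@Ordinal 2 1 isT)).
Proof.
by apply/funext => -[[|[|i]] lti] //=; rewrite /vec2 /=; congr (a _); apply: val_inj.
Qed.

Lemma vec3_eta X (a : 'I_3 -> X) :
  a = vec3 (a (@Ordinal 3 0 isT)) (a (@Ordinal 3 1 isT)) (a (@Ordinal 3 2 isT)).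
Proof.
by apply/funext => -[[|[|[|i]]] lti] //=; rewrite /vec3 /=; congr (a _); apply: val_inj.
Qed.

Lemma vec2_map X Y (h : X -> Y) x y : (fun i => h (vec2 x y i)) = vec2 (h x) (h y).
Proof. by apply/funext => -[[|i] ?]. Qed.

Lemma vec3_map X Y (h : X -> Y) x y z : (fun i => h (vec3 x y z i)) = vec3 (h x) (h y) (h z).
Proof. by apply/funext => -[[|[|i]] ?]. Qed.

Section Definable.
Variable W : vocabulary.

(** A property is stated as a proposition about all structures, and closure lemmas produce its
    formula; the axioms of psi are never written with explicit indices. *)
Definition definable n (Q : forall M : structure W, ('I_n -> M) -> Prop) :=
  exists phi : formula W n, forall M v, sat phi v <-> Q M v.

(** The quantifier supplies a variable when [n = 0]. *)
Definition top_formula n : formula W n := Ex (Eq (Var W ord0) (Var W ord0)).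

Lemma sat_top (M : structure W) n (v : 'I_n -> M) : sat (top_formula n) v.
Proof. by have [a] := carrier_inhabited M; exists a. Qed.

Section Connectives.
Variable n : nat.
Implicit Types A B : forall M : structure W, ('I_n -> M) -> Prop.

Lemma definable_ext A B : (forall M v, A M v <-> B M v) -> definable A -> definable B.
Proof. by move=> h [phi H]; exists phi => M v; rewrite H h. Qed.

Lemma definable_not A : definable A -> definable (fun M v => ~ A M v).
Proof. by move=> [phi H]; exists (Neg phi) => M v /=; rewrite H. Qed.

Lemma definable_const (c : Prop) : definable (fun (M : structure W) (_ : 'I_n -> M) => c).
Proof.
have [h|h] := pselect c; first by exists (top_formula n) => M v; split=> // _; exact: sat_top.
by exists (Neg (top_formula n)) => M v; split=> // H; case: H; exact: sat_top.
Qed.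

Lemma definable_countable (T : countType) (Q : T -> forall M : structure W, ('I_n -> M) -> Prop) :
  (forall t, definable (Q t)) -> definable (fun M v => forall t, Q t M v).
Proof.
move=> /choice[phi H].
exists (Conj (fun k => if unpickle k is Some t then phi t else top_formula n)) => M v /=.
split=> [h t|h k]; first by have := h (pickle t); rewrite pickleK H.
by case: (unpickle k) => [t|]; [rewrite H; exact: h|exact: sat_top].
Qed.

Lemma definable_and A B : definable A -> definable B -> definable (fun M v => A M v /\ B M v).
Proof.
by move=> [phi H] [psi H']; exists (and_formula phi psi) => M v; rewrite sat_and H H'.
Qed.

Lemma definable_imp A B : definable A -> definable B -> definable (fun M v => A M v -> B M v).
Proof.
move=> hA hB.
apply: definable_ext (definable_not (definable_and hA (definable_not hB))) => M v.
by split=> [h a|h [/h]//]; apply: contrapT => nb; apply: h.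
Qed.

Lemma definable_or A B : definable A -> definable B -> definable (fun M v => A M v \/ B M v).
Proof.
move=> hA hB; apply: definable_ext (definable_imp (definable_not hA) hB) => M v.
by split=> [h|[]//]; have [a|/h b] := pselect (A M v); [left|right].
Qed.

Lemma definable_exists_countable (T : countType)
    (Q : T -> forall M : structure W, ('I_n -> M) -> Prop) :
  (forall t, definable (Q t)) -> definable (fun M v => exists t, Q t M v).
Proof.
move=> h; have := definable_not (definable_countable (fun t => definable_not (h t))).
apply: definable_ext => M v; split=> [/existsNP[t /contrapT ?]|[t ?] h']; first by exists t.
exact: (h' t).
Qed.

Lemma definable_ex (Q : forall M : structure W, ('I_n -> M) -> M -> Prop) :
  definable (fun M (w : 'I_n.+1 -> M) => Q M (fun i => w (lift ord0 i)) (w ord0)) ->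
  definable (fun M v => exists a, Q M v a).
Proof.
have env M (v : 'I_n -> M) a : (fun i => extend_env a v (lift ord0 i)) = v.
  by apply/funext => i; rewrite extend_envS.
move=> [phi H]; exists (Ex phi) => M v /=.
by split=> -[a h]; exists a; move: h; rewrite H extend_env0 env.
Qed.

Lemma definable_eq i j : definable (fun M (v : 'I_n -> M) => v i = v j).
Proof. by exists (Eq (Var W i) (Var W j)). Qed.

Lemma definable_rel (r : rsym W) (ix : 'I_(rarity r) -> 'I_n) :
  definable (fun M (v : 'I_n -> M) => rinterp M r (fun k => v (ix k))).
Proof. by exists (Rel (fun k => Var W (ix k))). Qed.

Lemma definable_rel_fun (r : rsym W) (f : Defs.fsym W) (ix : 'I_(farity f) -> 'I_n) :
  definable (fun M (v : 'I_n -> M) => rinterp M r (fun=> finterp M f (fun k => v (ix k)))).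
Proof. by exists (@Rel W n r (fun=> App (fun k => Var W (ix k)))). Qed.

Lemma definable_fun (f : Defs.fsym W) (ix : 'I_(farity f) -> 'I_n) j :
  definable (fun M (v : 'I_n -> M) => finterp M f (fun k => v (ix k)) = v j).
Proof. by exists (Eq (App (fun k => Var W (ix k))) (Var W j)). Qed.

End Connectives.

Lemma definable_all n (Q : forall M : structure W, ('I_n -> M) -> M -> Prop) :
  definable (fun M (w : 'I_n.+1 -> M) => Q M (fun i => w (lift ord0 i)) (w ord0)) ->
  definable (fun M v => forall a, Q M v a).
Proof.
move=> h; have := definable_not (@definable_ex n (fun M v a => ~ Q M v a) (definable_not h)).
by apply: definable_ext => M v; split=> [/forallNP h' a|h' [a]//]; exact: contrapT.
Qed.


Lemma definable_exv m n (Q : forall M : structure W, ('I_n -> M) -> ('I_m -> M) -> Prop) :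
  definable (fun M (w : 'I_(m + n) -> M) =>
    Q M (fun i => w (rshift m i)) (fun i => w (lshift n i))) ->
  definable (fun M v => exists a, Q M v a).
Proof.
elim: m Q => [|m IH] Q h.
  apply: definable_ext h => M v; rewrite (_ : (fun i => v (rshift 0 i)) = v).
    split=> [H|[a H]]; first by eexists; exact: H.
    by rewrite (env0_eq (fun i => _) a).
  by apply/funext => i; congr v; exact: val_inj.
have h' : definable (fun M (v : 'I_n -> M) =>
    exists (a : 'I_m -> M) (b : M), Q M v (extend_env b a)).
  apply: IH; apply: definable_ex; apply: definable_ext h => M w.
  have -> : (fun i => w (lshift n i)) = extend_env (w ord0) (fun i => w (lift ord0 (lshift n i))).
    apply/funext => i; case: (unliftP ord0 i) => [j|] ->; rewrite ?extend_envS ?extend_env0;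
    by congr w; exact: val_inj.
  have -> : (fun i => w (rshift m.+1 i)) = (fun i => w (lift ord0 (rshift m i))) => //.
  by apply/funext => i; congr w; exact: val_inj.
apply: definable_ext h' => M v; split=> [[a [b H]]|[a H]]; first by exists (extend_env b a).
by exists (fun i => a (lift ord0 i)), (a ord0); rewrite extend_env_eta.
Qed.

Lemma definable_allv m n (Q : forall M : structure W, ('I_n -> M) -> ('I_m -> M) -> Prop) :
  definable (fun M (w : 'I_(m + n) -> M) =>
    Q M (fun i => w (rshift m i)) (fun i => w (lshift n i))) ->
  definable (fun M v => forall a, Q M v a).
Proof.
move=> h; have := definable_not (@definable_exv m n (fun M v a => ~ Q M v a) (definable_not h)).
by apply: definable_ext => M v; split=> [/forallNP h' a|h' [a]//]; exact: contrapT.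
Qed.

End Definable.

(** * The vocabulary of psi, its axioms, and the relativization of theta *)

Section Expansion.
Variables (V : vocabulary) (P : rsym V).

(** Pairs of booleans name the four new symbols. The map g enters through its graph, being defined
    on L * U only, while function symbols are total. *)
Definition expansion : vocabulary :=
  @Vocabulary (Defs.fsym V) (@farity V) (rsym V + bool * bool)%type (fun r => match r with
    | inl r => rarity r | inr (true, _) => 1 | inr (false, true) => 2
    | inr (false, false) => 3 end).

Let W := expansion.

Definition old (M : structure W) (x : M) : Prop := rinterp M (inr (true, true)) (fun=> x).
Definition new (M : structure W) (x : M) : Prop := ~ old x.
Definition inP (M : structure W) (x : M) : Prop := rinterp M (inl P) (fun=> x).
Definition inU (M : structure W) (x : M) : Prop := rinterp M (inr (true, false)) (fun=> x).
Definition below (M : structure W) (x y : M) : Prop := rinterp M (inr (false, true)) (vec2 x y).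
Definition maps (M : structure W) (x u y : M) : Prop :=
  rinterp M (inr (false, false)) (vec3 x u y).

(* Function symbols are total, so [f_junk] fixes their values outside the old
   sort; otherwise countable models would not be unique. In [f_point], a
   prescribed value [b i] that is not below [x] stands for [y] itself. *)
Record frame (M : structure W) : Prop := Frame {
  f_fclosed : forall f (a : 'I_(farity f) -> M), (forall i, old (a i)) -> old (finterp M f a);
  f_junk : forall f (a : 'I_(farity f) -> M) i, new (a i) ->
    (forall j : 'I_(farity f), j < i -> old (a j)) -> finterp M f a = a i;
  f_rel : forall r (a : 'I_(rarity r) -> M), rinterp M (inl r) a -> forall i, old (a i);
  f_UP : forall x : M, inU x -> inP x;
  f_coinf : forall k (c : 'I_k -> M), exists x : M, inP x /\ ~ inU x /\ forall i, c i <> x;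
  f_new : exists x : M, new x;
  f_below : forall x y : M, below x y -> new x /\ new y;
  f_irr : forall x : M, ~ below x x;
  f_trans : forall x y z : M, below x y -> below y z -> below x z;
  f_weak : forall x y z : M, new y -> below x z -> below x y \/ below y z;
  f_dense : forall x y : M, below x y -> exists z, below x z /\ below z y;
  f_above : forall x : M, new x -> exists y, below x y;
  f_under : forall x : M, new x -> exists y, below y x;
  f_dom : forall x u y : M, maps x u y -> new x /\ inU u /\ (y = x \/ below y x);
  f_total : forall x u : M, new x -> inU u -> exists y, maps x u y;
  f_fun : forall x u y z : M, maps x u y -> maps x u z -> y = z;
  f_row : forall m k (a b : 'I_m -> M) (c : 'I_k -> M), (forall i j, a i = a j -> i = j) ->
    (forall i, new (a i) /\ (b i = a i \/ below (b i) (a i))) ->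
    exists u, inU u /\ (forall j, c j <> u) /\ forall i, maps (a i) u (b i);
  f_point : forall m k (p b : 'I_m -> M) (c : 'I_k -> M) (x : M), new x ->
    (forall i j, p i = p j -> i = j) -> (forall i, inU (p i)) ->
    exists y, new y /\ ~ below x y /\ ~ below y x /\ (forall j, c j <> y) /\
      forall i, (below (b i) x -> maps y (p i) (b i)) /\ (~ below (b i) x -> maps y (p i) y);
  f_finite : forall m (p : 'I_m -> M) (x : M), new x -> (forall i, inU (p i)) ->
    exists k (c : 'I_k -> M), (exists i, c i = x) /\ (forall i, new (c i)) /\
      forall i j, exists l, maps (c i) (p j) (c l) }.

Lemma definable_old n i : definable (fun (M : structure W) (v : 'I_n -> M) => old (v i)).
Proof. exact: (definable_rel (r := inr (true, true) : rsym W) (fun=> i)). Qed.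

Lemma definable_old_fun n (f : Defs.fsym V) (ix : 'I_(farity f) -> 'I_n) :
  definable (fun (M : structure W) (v : 'I_n -> M) => old (finterp M f (fun k => v (ix k)))).
Proof. exact: (definable_rel_fun (inr (true, true) : rsym W) (f := f : Defs.fsym W)). Qed.

Lemma definable_inU n i : definable (fun (M : structure W) (v : 'I_n -> M) => inU (v i)).
Proof. exact: (definable_rel (r := inr (true, false) : rsym W) (fun=> i)). Qed.

Lemma definable_inP n i : definable (fun (M : structure W) (v : 'I_n -> M) => inP (v i)).
Proof. exact: (definable_rel (r := inl P : rsym W) (fun=> i)). Qed.

Lemma definable_below n i j :
  definable (fun (M : structure W) (v : 'I_n -> M) => below (v i) (v j)).
Proof.
apply: definable_ext (definable_rel (r := inr (false, true) : rsym W) (vec2 i j)) => M v.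
by rewrite /below -vec2_map.
Qed.

Lemma definable_maps n i j k :
  definable (fun (M : structure W) (v : 'I_n -> M) => maps (v i) (v j) (v k)).
Proof.
apply: definable_ext (definable_rel (r := inr (false, false) : rsym W) (vec3 i j k)) => M v.
by rewrite /maps -vec3_map.
Qed.

Ltac definability := repeat (cbv beta; first
  [ apply: definable_old | apply: definable_old_fun | apply: definable_inU | apply: definable_inP
  | apply: definable_below | apply: definable_maps | apply: definable_eq
  | apply: (@definable_fun W) | apply: (@definable_rel W)
  | apply: definable_const
  | apply: definable_and | apply: definable_or | apply: definable_not | apply: definable_imp
  | apply: definable_allv | apply: definable_exv
  | apply: definable_all | apply: definable_ex
  | apply: definable_countable => ? | apply: definable_exists_countable => ? ]).

(** The record is unfolded into nested conjunctions that [definability] can follow; quantifiers over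
    symbols, lengths and indices range over countable types and become countable conjunctions or
    disjunctions. *)
Lemma definable_frame : definable (fun (M : structure W) (_ : 'I_0 -> M) => frame M).
Proof.
apply: (@definable_ext _ _ (fun M _ =>
    (forall f (a : 'I_(farity f) -> M), (forall i, old (a i)) -> old (finterp M f a)) /\
    (forall f (a : 'I_(farity f) -> M) i, new (a i) ->
      (forall j : 'I_(farity f), j < i -> old (a j)) -> finterp M f a = a i) /\
    (forall r (a : 'I_(rarity r) -> M), rinterp M (inl r) a -> forall i, old (a i)) /\
    (forall x : M, inU x -> inP x) /\
    (forall k (c : 'I_k -> M), exists x : M, inP x /\ ~ inU x /\ forall i, c i <> x) /\
    (exists x : M, new x) /\
    (forall x y : M, below x y -> new x /\ new y) /\
    (forall x : M, ~ below x x) /\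
    (forall x y z : M, below x y -> below y z -> below x z) /\
    (forall x y z : M, new y -> below x z -> below x y \/ below y z) /\
    (forall x y : M, below x y -> exists z, below x z /\ below z y) /\
    (forall x : M, new x -> exists y, below x y) /\
    (forall x : M, new x -> exists y, below y x) /\
    (forall x u y : M, maps x u y -> new x /\ inU u /\ (y = x \/ below y x)) /\
    (forall x u : M, new x -> inU u -> exists y, maps x u y) /\
    (forall x u y z : M, maps x u y -> maps x u z -> y = z) /\
    (forall m k (a b : 'I_m -> M) (c : 'I_k -> M), (forall i j, a i = a j -> i = j) ->
      (forall i, new (a i) /\ (b i = a i \/ below (b i) (a i))) ->
      exists u, inU u /\ (forall j, c j <> u) /\ forall i, maps (a i) u (b i)) /\
    (forall m k (p b : 'I_m -> M) (c : 'I_k -> M) (x : M), new x ->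
      (forall i j, p i = p j -> i = j) -> (forall i, inU (p i)) ->
      exists y, new y /\ ~ below x y /\ ~ below y x /\ (forall j, c j <> y) /\
      forall i, (below (b i) x -> maps y (p i) (b i)) /\ (~ below (b i) x -> maps y (p i) y)) /\
    (forall m (p : 'I_m -> M) (x : M), new x -> (forall i, inU (p i)) ->
      exists k (c : 'I_k -> M), (exists i, c i = x) /\ (forall i, new (c i)) /\
      forall i j, exists l, maps (c i) (p j) (c l)))).
  move=> M _; split=> H; first by do 18!(case: H => ? H).
  by case: H => *; do !(split; first assumption).
rewrite /new; definability.
Qed.


Fixpoint expand_term n (t : term V n) : term W n := match t with
  | Var i => Var W i
  | App f ts => @App W n (f : Defs.fsym W) (fun i => expand_term (ts i)) end.

Fixpoint relativize n (phi : formula V n) : formula W n := match phi with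
  | Eq _ t u => Eq (expand_term t) (expand_term u)
  | Rel _ r ts => @Rel W _ (inl r : rsym W) (fun i => expand_term (ts i))
  | Neg _ psi => Neg (relativize psi)
  | Conj _ psis => Conj (fun k => relativize (psis k))
  | Ex _ psi => Ex (and_formula (@Rel W _ (inr (true, true) : rsym W) (fun=> Var W ord0))
      (relativize psi)) end.

Definition reduct (M : structure W) : structure V :=
  @Structure V M (carrier_inhabited M) (fun f => finterp M (f : Defs.fsym W))
    (fun r => rinterp M (inl r : rsym W)).

Definition old_part (M : structure W) clH inh : structure V :=
  @substructure V (reduct M) (@old M) clH inh.

Lemma relativizeP (M : structure W) clH inh n (phi : formula V n)
    (v : 'I_n -> @old_part M clH inh) :
  sat (relativize phi) (fun i => sval (v i) : M) <-> sat phi v.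
Proof.
have evalE m (t : term V m) (w : 'I_m -> old_part clH inh) :
    eval (fun i => sval (w i) : M) (expand_term t) = sval (eval w t).
  elim: t => //= f ts IH; congr (finterp _ _ _); exact/funext.
elim: phi v => {n} [n t u|n r ts|n phi IH|n phi IH|n phi IH] v.
- by rewrite /= !evalE; split=> [|->//]; exact: sval_inj.
- rewrite /=; set a := fun i => _; set b := fun i => _; suff -> : a = b by [].
  by apply/funext => i; rewrite /a evalE.
- by rewrite /= IH.
- by rewrite /=; split=> h k; apply/IH/h.
- have key (a : old_part clH inh) : (extend_env (sval a : M) (fun i => sval (v i) : M)) =
      fun i => sval (extend_env a v i) by rewrite extend_env_map.
  rewrite /=; split=> [[a /sat_and[/= oa]]|[a]].
    move: oa; rewrite extend_env0 => oa.
    by rewrite (key (exist _ a oa)) IH => h; exists (exist _ a oa).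
  rewrite -IH => h; exists (sval a); apply/sat_and; rewrite key; split=> //=.
  by rewrite extend_env0; exact: (svalP a).
Qed.

End Expansion.

(** * Extending finite partial isomorphisms *)

(** Take an element of [Q] with the most predecessors: an [r]-successor of it would inherit them by
    transitivity and gain the element itself. *)
Lemma finite_maximal k (r : 'I_k -> 'I_k -> Prop) (Q : 'I_k -> Prop) i0 :
  (forall i, ~ r i i) -> (forall i j l, r i j -> r j l -> r i l) -> Q i0 ->
  exists i, Q i /\ forall j, Q j -> ~ r i j.
Proof.
move=> irr tr Qi0; pose D i := [set l | `[< r l i >]].
have Qi0' : `[< Q i0 >] by apply/asboolP.
have [i /asboolP Qi imax] := arg_maxnP (P := fun i => `[< Q i >]) (fun i => #|D i|) Qi0'.
exists i; split=> // j Qj rij; have := imax j (introT (asboolP _) Qj).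
apply/negP; rewrite -ltnNge; apply: proper_card; apply/properP; split.
  apply/fintype.subsetP => l; rewrite !finset.in_set => /asboolP rli; apply/asboolP.
  exact: tr rij.
by exists i; rewrite finset.in_set; apply/asboolP.
Qed.

Section Frame.
Variables (V : vocabulary) (P : rsym V) (M : structure (expansion V)).
Hypotheses (rarP : rarity P = 1) (F : frame P M).

Lemma inP_old (x : M) : inP P x -> old x.
Proof.
by move=> /(f_rel F)/(_ (cast_ord (esym rarP) ord0)).
Qed.

Lemma inU_old (x : M) : inU x -> old x.
Proof. by move=> /(f_UP F)/inP_old. Qed.

Lemma frame_old : exists x : M, old x.
Proof.
(* The empty instance of [f_row] yields an element of U. *)
have [||u [/inU_old uo _]] := @f_row _ _ _ F 0 0 (fun i => False_rect M (notF (ltn_ord i)))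
  (fun i => False_rect M (notF (ltn_ord i))) (fun i => False_rect M (notF (ltn_ord i))).
- by move=> [].
- by move=> [].
by exists u.
Qed.

Lemma f_reach (x y : M) : below y x -> exists u, inU u /\ maps x u y.
Proof.
move=> yx; have [_ nx] := f_below F yx.
have [||u [uU [_ /(_ ord0)]]] := @f_row _ _ _ F 1 1 (fun=> x) (fun=> y) (fun=> x).
- by move=> i j _; rewrite (ord1 i) (ord1 j).
- by move=> _; split=> //; right.
by exists u.
Qed.

Lemma segment_embeds (x : M) : embeds {y | below y x} {u : M | inU u}.
Proof.
have /choice[f fP] : forall y : {y | below y x}, exists u : {u : M | inU u},
    maps x (sval u) (sval y).
  by move=> [y yx]; have [u [uU h]] := f_reach yx; exists (exist _ u uU).
exists f => y z e; apply: sval_inj; have := fP z; rewrite -e; exact: f_fun F _ _ _ _ (fP y).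
Qed.

Lemma below_level (x y z : M) : new x -> new y -> ~ below x y -> ~ below y x ->
  (below x z <-> below y z) /\ (below z x <-> below z y).
Proof.
move=> nx ny xy yx; split; split=> h.
- by case: (f_weak F ny h).
- by case: (f_weak F nx h).
- by case: (f_weak F ny h).
- by case: (f_weak F nx h).
Qed.

(** In a weak order it suffices to compare [x] with a top element of [lo] and a bottom element of
    its complement; density separates these two, and an empty side is covered by the absence of
    endpoints. *)
Lemma interval k (c : 'I_k -> M) (lo : 'I_k -> Prop) : (forall i, new (c i)) ->
  (forall i j, lo i -> ~ lo j -> below (c i) (c j)) ->
  exists x, new x /\ forall i, (lo i -> below (c i) x) /\ (~ lo i -> below x (c i)).
Proof.
move=> nc lohi.
have maxlo : (forall i, ~ lo i) \/ exists i, lo i /\ forall j, lo j -> ~ below (c i) (c j).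
  have [[i li]|no] := pselect (exists i, lo i); last by left=> i li; apply: no; exists i.
  right; apply: (finite_maximal (r := fun i j => below (c i) (c j)) _ _ li) => [i'|? ? ?].
    exact: f_irr F _.
  exact: f_trans F _ _ _.
have minhi : (forall i, lo i) \/ exists i, ~ lo i /\ forall j, ~ lo j -> ~ below (c j) (c i).
  have [[i li]|no] := pselect (exists i, ~ lo i); last first.
    by left=> i; apply: contrapT => li; apply: no; exists i.
  right; apply: (finite_maximal (r := fun i j => below (c j) (c i)) _ _ li) => [i'|? ? ? h h'].
    exact: f_irr F _.
  exact: f_trans F _ _ _ h' h.
suff [x [nx [h1 h2]]] : exists x, new x /\
    (forall i, lo i -> (forall j, lo j -> ~ below (c i) (c j)) -> below (c i) x) /\
    (forall i, ~ lo i -> (forall j, ~ lo j -> ~ below (c j) (c i)) -> below x (c i)).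
  exists x; split=> // i; split=> li.
    case: maxlo => [/(_ i)//|[m [lm mm]]]; have [//|//] := f_weak F (nc i) (h1 m lm mm).
    by move/mm: li.
  case: minhi => [/(_ i)//|[m [lm mm]]]; have [//|//] := f_weak F (nc i) (h2 m lm mm).
  by move/mm: li.
case: maxlo => [nolo|[m [lm mm]]]; case: minhi => [nohi|[l [ll ml]]].
- have [x nx] := f_new F; exists x; split=> //; split=> i h _; first by case: (nolo i).
  by case: h.
- have [x xl] := f_under F (nc l); exists x; split; first by case: (f_below F xl).
  split=> i h hm; first by case: (nolo i).
  have ncl : ~ below (c i) (c l) by exact: ml.
  have ncl' : ~ below (c l) (c i) by exact: hm.
  by apply/(proj2 (below_level x (nc i) (nc l) ncl ncl')).
- have [x xl] := f_above F (nc m); exists x; split; first by case: (f_below F xl).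
  split=> i h hm; last by case: h.
  have ncl : ~ below (c i) (c m) by exact: hm.
  have ncl' : ~ below (c m) (c i) by exact: mm.
  by apply/(proj1 (below_level x (nc i) (nc m) ncl ncl')).
- have [x [mx xl]] := f_dense F (lohi _ _ lm ll).
  exists x; split; first by case: (f_below F xl).
  split=> i h hm.
    have ncl : ~ below (c i) (c m) by exact: hm.
    have ncl' : ~ below (c m) (c i) by exact: mm.
    by apply/(proj1 (below_level x (nc i) (nc m) ncl ncl')).
  have ncl : ~ below (c i) (c l) by exact: ml.
  have ncl' : ~ below (c l) (c i) by exact: hm.
  by apply/(proj2 (below_level x (nc i) (nc l) ncl ncl')).
Qed.

End Frame.

Section PartialIsomorphism.
Variables (V : vocabulary) (P : rsym V).
Implicit Types M N : structure (expansion V).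

(** Both tuples of points are closed under the listed u, with the same index [l] on either side. Of
    [p] and [p'] only injectivity is asked, since the theta-part will be adjusted afterwards by
    indiscernibility. *)
Record partial_iso M N m n (a : 'I_m -> M) (a' : 'I_m -> N) (p : 'I_n -> M) (p' : 'I_n -> N) :
    Prop := PartialIso {
  pi_new : forall i, new (a i) /\ new (a' i);
  pi_inj : injective a /\ injective a';
  pi_below : forall i j, below (a i) (a j) <-> below (a' i) (a' j);
  pi_inU : forall i, inU (p i) /\ inU (p' i);
  pi_injU : injective p /\ injective p';
  pi_maps : forall i j, exists l, maps (a i) (p j) (a l) /\ maps (a' i) (p' j) (a' l) }.

Lemma partial_iso_sym M N m n (a : 'I_m -> M) (a' : 'I_m -> N) (p : 'I_n -> M) (p' : 'I_n -> N) :
  partial_iso a a' p p' -> partial_iso a' a p' p.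
Proof.
move=> [h1 [h2 h2'] h3 h4 [h5 h5'] h6]; split=> //.
- by move=> i; case: (h1 i).
- by move=> i j; rewrite h3.
- by move=> i; case: (h4 i).
- by move=> i j; have [l [? ?]] := h6 i j; exists l.
Qed.

Lemma extend_env_inj X m (y : X) (a : 'I_m -> X) :
  injective a -> (forall i, a i <> y) -> injective (extend_env y a).
Proof.
move=> ainj ay i j; case: (unliftP ord0 i) => [i'|] ->; case: (unliftP ord0 j) => [j'|] ->;
  rewrite ?extend_env0 ?extend_envS //.
- by move/ainj->.
- by move/ay.
- by move/esym/ay.
Qed.

Variables (M N : structure (expansion V)).
Hypotheses (FM : frame P M) (FN : frame P N).

(** Level and row are found separately: [x'] realizes the cut of [y], then [f_point] gives a fresh
    [y'] on the level of [x'] with the prescribed values. *)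
Lemma add_point m n (a : 'I_m -> M) (a' : 'I_m -> N) (p : 'I_n -> M) (p' : 'I_n -> N) y :
  partial_iso a a' p p' -> new y -> (forall i, a i <> y) ->
  (forall j z, maps y (p j) z -> z = y \/ exists l, z = a l) ->
  exists y', partial_iso (extend_env y a) (extend_env y' a') p p'.
Proof.
move=> [anew [ainj ainj'] abelow pU [pinj pinj'] amaps] ny ay ymaps.
have [x' [nx' xcut]] : exists x' : N, new x' /\ forall i,
    (below (a i) y <-> below (a' i) x') /\ (below y (a i) <-> below x' (a' i)).
  have [[i [ai ia]]|no] := pselect (exists i, ~ below (a i) y /\ ~ below y (a i)).
    exists (a' i); split; first by case: (anew i).
    move=> j; have [h h'] := below_level FM (a j) (proj1 (anew i)) ny ai ia.
    by rewrite -h -h' !abelow.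
  have [||x' [nx' h]] := interval FN (c := a') (lo := fun i => below (a i) y).
  - by move=> i; case: (anew i).
  - move=> i j iy jy; apply/abelow; apply: (f_trans FM iy).
    by apply: contrapT => yj; apply: no; exists j.
  exists x'; split=> // i; have [h1 h2] := h i.
  have asym (z w : M) : below z w -> ~ below w z.
    by move=> zw /(f_trans FM zw); exact: f_irr FM _.
  have asym' (z w : N) : below z w -> ~ below w z.
    by move=> zw /(f_trans FN zw); exact: f_irr FN _.
  have [iy|iy] := pselect (below (a i) y).
    by split; split=> // [yi|xi]; [case: (asym _ _ iy)|case: (asym' _ _ (h1 iy))].
  have yi : below y (a i) by apply: contrapT => yi; apply: no; exists i.
  split; split=> // ax; last exact: h2 iy.
  by case: (asym' _ _ (h2 iy)).
(* Where [p j] fixes [y] the prescribed value is [x']: it is not below itself, so [f_point] makes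
   [p' j] fix [y']. *)
have /choice[b bP] : forall j, exists b : N,
    (exists l, [/\ maps y (p j) (a l), below (a l) y & b = a' l]) \/ maps y (p j) y /\ b = x'.
  move=> j; have [z yz] := f_total FM ny (proj1 (pU j)).
  case: (ymaps j z yz) => [e|[l e]]; subst z; first by exists x'; right.
  exists (a' l); left; exists l; split=> //.
  by have [_ [_ [/ay|]]] := f_dom FM yz.
have [y' [ny' [xy [yx [nay' ymaps']]]]] := f_point FN b a' nx' pinj'
  (fun j => proj2 (pU j)).
have lev z := below_level FN z nx' ny' xy yx.
exists y'; split=> //.
- by move=> i; case: (unliftP ord0 i) => [i'|] ->; rewrite ?extend_env0 ?extend_envS.
- by split; apply: extend_env_inj.
- move=> i j; case: (unliftP ord0 i) => [i'|] ->; case: (unliftP ord0 j) => [j'|] ->;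
    rewrite ?extend_env0 ?extend_envS //.
  + by rewrite (proj1 (xcut i')); case: (lev (a' i')).
  + by rewrite (proj2 (xcut j')); case: (lev (a' j')).
  + by split=> h; [case: (f_irr FM h)|case: (f_irr FN h)].
- move=> i j; case: (unliftP ord0 i) => [i'|] ->; rewrite ?extend_env0 ?extend_envS.
    by have [l [h h']] := amaps i' j; exists (lift ord0 l); rewrite !extend_envS.
  have [h1 h2] := ymaps' j; case: (bP j) => [[l [yl ly bl]]|[yy bx]].
    exists (lift ord0 l); rewrite !extend_envS; split=> //; rewrite -bl; apply: h1.
    by rewrite bl; apply/(proj1 (xcut l)).
  exists ord0; rewrite !extend_env0; split=> //; apply: h2; rewrite bx; exact: f_irr FN _.
Qed.

Definition extends m n m2 n2 (a : 'I_m -> M) (a' : 'I_m -> N) (p : 'I_n -> M) (p' : 'I_n -> N)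
    (b : 'I_m2 -> M) (b' : 'I_m2 -> N) (q : 'I_n2 -> M) (q' : 'I_n2 -> N) :=
  (forall i, exists j, b j = a i /\ b' j = a' i) /\
  (forall i, exists j, q j = p i /\ q' j = p' i).

(** Points are added from the lowest level up: by regressivity the values of a minimal missing point
    are itself or already present, as [add_point] requires. That nothing else is added matters for
    [add_inU]. *)
Lemma add_set k (c : 'I_k -> M) m n (a : 'I_m -> M) (a' : 'I_m -> N)
    (p : 'I_n -> M) (p' : 'I_n -> N) :
  partial_iso a a' p p' -> (forall i, new (c i)) ->
  (forall i j, exists l, maps (c i) (p j) (c l)) ->
  exists m2 (b : 'I_m2 -> M) (b' : 'I_m2 -> N), [/\ partial_iso b b' p p',
    extends a a' p p' b b' p p', forall i, exists j, b j = c i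
    & forall j, (exists i, b j = a i) \/ exists i, b j = c i].
Proof.
move=> pi nc ccl; pose miss m (a : 'I_m -> M) := [set i | `[< forall j, a j <> c i >]].
have [N' leN] := ubnP #|miss m a|; elim: N' => // N' IH in m a a' pi leN *.
have [[i0 mi0]|nomiss] := pselect (exists i, forall j, a j <> c i); last first.
  exists m, a, a'; split=> //; first by split=> i; exists i.
    move=> i; apply: contrapT => h; apply: nomiss; exists i => j e; apply: h; by exists j.
  by move=> j; left; exists j.
have [i [mi imin]] : exists i, (forall j, a j <> c i) /\
    forall l, (forall j, a j <> c l) -> ~ below (c l) (c i).
  apply: (finite_maximal (r := fun i j => below (c j) (c i)) _ _ mi0) => [i'|? ? ? h h'].
    exact: f_irr FM _.
  exact: f_trans FM _ _ _ h' h.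
have [|y' pi'] := add_point pi (nc i) mi.
  move=> j z yz; have [l cl] := ccl i j; rewrite (f_fun FM yz cl).
  have [_ [_ [->|li]]] := f_dom FM cl; first by left.
  right; apply: contrapT => h; apply: (imin l _ li) => j' e; apply: h; by exists j'.
have [|m2 [b [b' [pib [ext _] bc brange]]]] := IH _ _ _ pi'.
  rewrite ltnS in leN; apply: leq_trans leN; apply: proper_card; apply/properP; split.
    apply/fintype.subsetP => l; rewrite !finset.in_set => /asboolP h; apply/asboolP => j.
    by have := h (lift ord0 j); rewrite extend_envS.
  exists i; rewrite finset.in_set; first exact/asboolP.
  by apply/asboolP => /(_ ord0); rewrite extend_env0.
exists m2, b, b'; split=> //.
- split=> [j|j]; last by exists j.
  by have [l] := ext (lift ord0 j); rewrite !extend_envS; exists l.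
- move=> j; have [[l e]|h] := brange j; last by right.
  move: e; case: (unliftP ord0 l) => [l'|] ->; rewrite ?extend_env0 ?extend_envS => e.
    by left; exists l'.
  by right; exists i.
Qed.

Lemma add_new m n (a : 'I_m -> M) (a' : 'I_m -> N) (p : 'I_n -> M) (p' : 'I_n -> N) y :
  partial_iso a a' p p' -> new y ->
  exists m2 (b : 'I_m2 -> M) (b' : 'I_m2 -> N), [/\ partial_iso b b' p p',
    extends a a' p p' b b' p p' & exists j, b j = y].
Proof.
move=> pi ny; have [k [c [[i ci] [nc ccl]]]] := f_finite FM ny (fun i => proj1 (pi_inU pi i)).
have [m2 [b [b' [pib ext bc _]]]] := add_set pi nc ccl.
by exists m2, b, b'; split=> //; rewrite -ci.
Qed.

(** The points are first enlarged to a set closed under [u] as well. The values of [u] on it,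
    carried over to N, form a regressive pattern, which [f_row] realizes by a [u'] outside [p']. *)
Lemma add_inU m n (a : 'I_m -> M) (a' : 'I_m -> N) (p : 'I_n -> M) (p' : 'I_n -> N) u :
  partial_iso a a' p p' -> inU u ->
  exists m2 n2 (b : 'I_m2 -> M) (b' : 'I_m2 -> N) (q : 'I_n2 -> M) (q' : 'I_n2 -> N),
  [/\ partial_iso b b' q q', extends a a' p p' b b' q q' & exists j, q j = u].
Proof.
move=> pi uU.
have [up|nup] := pselect (exists j, p j = u).
  by exists m, n, a, a', p, p'; split=> //; split=> i; exists i.
pose pu := extend_env u p.
have puU i : inU (pu i).
  by rewrite /pu; case: (unliftP ord0 i) => [j|] ->; rewrite ?extend_env0 ?extend_envS //;
    case: (pi_inU pi j).
have /choice[S SP] : forall i, exists S : set M, [/\ finite_set S, S (a i),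
    forall x, S x -> new x & forall x j, S x -> exists y, S y /\ maps x (pu j) y].
  move=> i; have [k [c [ci [nc ccl]]]] := f_finite FM (proj1 (pi_new pi i)) puU.
  exists [set y | exists i, c i = y]%classic; split=> //; first exact: finite_range.
    by move=> x [l <-].
  by move=> x j [l <-]; have [l' h] := ccl l j; exists (c l'); split=> //; exists l'.
have [|k [c cP]] := @finite_set_vector M (\bigcup_(i in [set: 'I_m]) S i)%classic.
  by apply: bigcup_finite => [|i _]; [exact: finite_finset|case: (SP i)].
have cS i : exists i0, S i0 (c i).
  have [i0 _ h] : (\bigcup_(i in [set: 'I_m]) S i)%classic (c i) by apply/cP; exists i.
  by exists i0.
have ccl i j : exists l, maps (c i) (pu j) (c l).
  have [i0 h] := cS i; have [_ _ _ /(_ _ j h)[y [Sy my]]] := SP i0.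
  by have [l cl] : exists l, c l = y by [apply/cP; exists i0]; exists l; rewrite cl.
have nc i : new (c i) by have [i0 h] := cS i; have [_ _ /(_ _ h)] := SP i0.
have [|m2 [b [b' [pib [ext _] bc brange]]]] := add_set pi nc.
  by move=> i j; have := ccl i (lift ord0 j); rewrite /pu extend_envS.
have bumaps i : exists l, maps (b i) u (b l).
  have [i0 ->] : exists i0, b i = c i0.
    case: (brange i) => [[i1 ->]|//].
    have /cP[l <-] : (\bigcup_(i in [set: 'I_m]) S i)%classic (a i1).
      by exists i1 => //; case: (SP i1).
    by exists l.
  have [l] := ccl i0 ord0; have [l' <-] := bc l.
  by rewrite /pu extend_env0; exists l'.
have [s sP] := choice bumaps.
have [bnew [binj binj'] bbelow qU [qinj qinj'] bmaps] := pib.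
have [||u' [uU' [np' umaps]]] := f_row FN (a := b') (b := fun i => b' (s i)) p'.
- by move=> i j /binj'.
- move=> i; split; first by case: (bnew i).
  have [_ [_ [/binj ->|]]] := f_dom FM (sP i); first by left.
  by rewrite bbelow; right.
exists m2, n.+1, b, b', pu, (extend_env u' p'); split; last first.
- by exists ord0; rewrite /pu extend_env0.
- by split=> // i; exists (lift ord0 i); rewrite /pu !extend_envS.
split=> //.
- by move=> i; split=> //; case: (unliftP ord0 i) => [j|] ->;
    rewrite ?extend_env0 ?extend_envS //; case: (qU j).
- split; apply: extend_env_inj => // i e; by apply: nup; exists i.
- move=> i j; case: (unliftP ord0 j) => [j'|] ->; rewrite /pu ?extend_env0 ?extend_envS //.
  by exists (s i).
Qed.

End PartialIsomorphism.

(** * Countable models of psi are isomorphic *)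

Section CountableFrames.
Variables (V : vocabulary) (P : rsym V) (rarP : rarity P = 1).

Record state (M N : structure (expansion V)) := State {
  st_m : nat; st_n : nat;
  st_a : 'I_st_m -> M; st_a' : 'I_st_m -> N;
  st_p : 'I_st_n -> M; st_p' : 'I_st_n -> N;
  st_pi : partial_iso st_a st_a' st_p st_p' }.

Arguments st_a {M N} s _ : rename.
Arguments st_a' {M N} s _ : rename.
Arguments st_p {M N} s _ : rename.
Arguments st_p' {M N} s _ : rename.

Definition state_graph M N (c : state M N) x y :=
  (exists i, st_a c i = x /\ st_a' c i = y) \/ (exists i, st_p c i = x /\ st_p' c i = y).

Definition state_swap M N (c : state M N) : state N M :=
  State (partial_iso_sym (st_pi c)).

Lemma state_graph_swap M N (c : state M N) x y :
  state_graph (state_swap c) y x <-> state_graph c x y.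
Proof. by split=> -[[i [? ?]]|[i [? ?]]]; [left|right|left|right]; exists i. Qed.

Definition active (M : structure (expansion V)) (x : M) := new x \/ inU x.

Lemma state_forth (M N : structure (expansion V)) (FM : frame P M) (FN : frame P N)
    (c : state M N) x : active x ->
  exists c' y, (forall x y, state_graph c x y -> state_graph c' x y) /\ state_graph c' x y.
Proof.
move=> [nx|ux].
  have [m [b [b' [pib [e1 e2] [j bj]]]]] := add_new FM FN (st_pi c) nx.
  exists (State pib), (b' j); split; last by left; exists j.
  move=> x' y' [[i [<- <-]]|[i [<- <-]]]; first by left; have [l [? ?]] := e1 i; exists l.
  by right; exists i.
have [m [n [b [b' [q [q' [pib [e1 e2] [j bj]]]]]]]] := add_inU FM FN (st_pi c) ux.
exists (State pib), (q' j); split; last by right; exists j.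
move=> x' y' [[i [<- <-]]|[i [<- <-]]].
  by left; have [l [? ?]] := e1 i; exists l.
by right; have [l [? ?]] := e2 i; exists l.
Qed.

Lemma frame_bijection (M N : structure (expansion V)) :
  frame P M -> frame P N -> embeds M nat -> embeds N nat ->
  exists f : M -> N, [/\ set_bij (@active M) (@active N) f,
    forall x, new x -> new (f x), forall x, inU x -> inU (f x),
    forall x y, new x -> new y -> (below x y <-> below (f x) (f y))
    & forall x u z, new x -> inU u -> new z -> (maps x u z <-> maps (f x) (f u) (f z))].
Proof.
move=> FM FN cM cN; have [y0] := carrier_inhabited N.
have pi0 : partial_iso (@empty_env M) (@empty_env N) (@empty_env M) (@empty_env N).
  by split; try (by case); split=> -[].
have oldUM x : inU x -> ~ new (M := M) x by move=> /(inU_old rarP FM) ? ?.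
have oldUN x : inU x -> ~ new (M := N) x by move=> /(inU_old rarP FN) ? ?.
have [|||||s [f [smono sf fA fb _]]] := @back_and_forth M N (state M N)
  (@state_graph M N) (@active M) (@active N) (fun _ _ => True) (State pi0) y0 cM cN.
- move=> c x y [[i [<- <-]]|[i [<- <-]]].
    by have [? ?] := pi_new (st_pi c) i; split; left.
  by have [? ?] := pi_inU (st_pi c) i; split; right.
- move=> c x y x' y'; have [ainj ainj'] := pi_inj (st_pi c).
  have [pinj pinj'] := pi_injU (st_pi c).
  have diff i j : st_a c i <> st_p c j /\ st_a' c i <> st_p' c j.
    have [n1 n2] := pi_new (st_pi c) i; have [u1 u2] := pi_inU (st_pi c) j.
    by split=> e; [apply: (oldUM _ u1); rewrite -e|apply: (oldUN _ u2); rewrite -e].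
  move=> [[i [<- <-]]|[i [<- <-]]] [[j [<- <-]]|[j [<- <-]]].
  + by split=> [/ainj->|/ainj'->].
  + by have [? ?] := diff i j; split.
  + by have [d d'] := diff j i; split=> /esym.
  + by split=> [/pinj->|/pinj'->].
- by move=> c x; apply: state_forth.
- move=> c y /(state_forth FN FM (state_swap c))[c' [x [cc' c'x]]].
  exists (state_swap c'), x; split; last by apply/state_graph_swap.
  by move=> a b h; apply/state_graph_swap/cc'/state_graph_swap.
- by move=> _ c; exists c.
have fnew x n : new x -> state_graph (s n) x (f x) ->
    exists i, st_a (s n) i = x /\ st_a' (s n) i = f x.
  move=> nx [//|[i [e _]]]; have [u1 _] := pi_inU (st_pi (s n)) i.
  by case: (oldUM _ u1); rewrite e.
have fU x n : inU x -> state_graph (s n) x (f x) ->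
    exists i, st_p (s n) i = x /\ st_p' (s n) i = f x.
  move=> ux [[i [e _]]|//]; have [u1 _] := pi_new (st_pi (s n)) i.
  by case: (oldUM _ ux); rewrite -e.
have common x y : active x -> active y ->
    exists n, state_graph (s n) x (f x) /\ state_graph (s n) y (f y).
  move=> /fA[n nx] /fA[m my]; exists (maxn n m).
  by split; [apply: smono nx; exact: leq_maxl|apply: smono my; exact: leq_maxr].
exists f; split=> //.
- move=> x nx; have [n /(fnew _ _ nx)[i [_ <-]]] := fA x (or_introl nx).
  by case: (pi_new (st_pi (s n)) i).
- move=> x nx; have [n /(fU _ _ nx)[i [_ <-]]] := fA x (or_intror nx).
  by case: (pi_inU (st_pi (s n)) i).
- move=> x y nx ny; have [n [hx hy]] := common x y (or_introl nx) (or_introl ny).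
  have [i [<- <-]] := fnew _ _ nx hx; have [j [<- <-]] := fnew _ _ ny hy.
  exact: (pi_below (st_pi (s n))).
- move=> x u z nx uu nz; have [n [hx hu]] := common x u (or_introl nx) (or_intror uu).
  have [i [ex ex']] := fnew _ _ nx hx; have [j [eu eu']] := fU _ _ uu hu.
  have [l []] := pi_maps (st_pi (s n)) i j; rewrite ex ex' eu eu' => h h'.
  have fl : f (st_a (s n) l) = st_a' (s n) l by apply: (sf n); left; exists l.
  have nl : new (st_a (s n) l) by case: (pi_new (st_pi (s n)) l).
  split=> [m|m]; first by rewrite (f_fun FM m h) fl.
  have := f_fun FN m h'; rewrite -fl; have [_ finj _] := fb => /finj -> //; apply: mem_set; by left.
Qed.

Lemma infinite_card_eq_bij X Y (y0 : Y) (A : set X) (B : set Y) :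
  embeds X nat -> embeds Y nat -> infinite_set A -> infinite_set B ->
  exists f : X -> Y, set_bij A B f.
Proof.
have ct Z (C : set Z) : embeds Z nat -> countable C.
  by move=> /embedsP; apply: card_le_trans; exact: card_leT.
move=> /(ct _ A) cA /(ct _ B) cB iA iB.
have : (A #= B)%card.
  apply: (card_eq_trans (B := [set: nat]%classic)); first exact: eq_card_nat.
  by apply: card_esym; exact: eq_card_nat.
elim/Ppointed: Y y0 B {cB iB} => Y y0 B; last by move=> /card_set_bijP.
by have : [set: Y]%classic y0 by []; rewrite emptyE.
Qed.

Lemma least_ordinal k (Q : 'I_k -> Prop) i0 : Q i0 ->
  exists i, Q i /\ forall j : 'I_k, j < i -> ~ Q j.
Proof.
move=> /asboolP Qi0.
have [i /asboolP Qi imin] := arg_minnP (P := fun i => `[< Q i >]) (fun i => i) Qi0.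
exists i; split=> // j ji /asboolP /imin; by rewrite leqNgt ji.
Qed.

Lemma infinite_coU (M : structure (expansion V)) : frame P M ->
  infinite_set [set x : M | inP P x /\ ~ inU x]%classic.
Proof.
move=> FM /finite_set_vector[k [c cP]].
have [x [Px [Ux cx]]] := f_coinf FM c.
by have /cP[i] : [set x : M | inP P x /\ ~ inU x]%classic x by []; exact: cx.
Qed.

Definition frame_part (M : structure (expansion V)) (F : frame P M) : structure V :=
  @old_part V M (f_fclosed F) (frame_old rarP F).

(** [f] matches the new sort and U; an arbitrary bijection [q] matches the complements of U in P,
    both countably infinite by [f_coinf]. Together they biject the two sets P, and the extension to
    the theta-parts is glued with [f] on the new sort. *)
Lemma frame_isomorphism (theta : sentence V) (M0 : structure V) (M N : structure (expansion V))
    (FM : frame P M) (FN : frame P N) :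
  complete theta -> models M0 theta -> embeds M0 nat -> absolute_indiscernibles M0 P ->
  models (frame_part FM) theta -> models (frame_part FN) theta ->
  embeds M nat -> embeds N nat -> exists h : M -> N, isomorphism h.
Proof.
move=> cth M0t cM0 indisc Mt Nt cM cN; have [y0] := carrier_inhabited N.
have [f [[fact finj fsurj] fnew fU fbelow fmaps]] := frame_bijection FM FN cM cN.
have [q [qQ qinj qsurj]] := infinite_card_eq_bij y0 cM cN (infinite_coU FM) (infinite_coU FN).
pose fP (x : M) := if `[< inU x >] then f x else q x.
have fPU (x : M) : inU x -> fP x = f x by move=> ux; rewrite /fP; case: asboolP.
have fPQ (x : M) : ~ inU x -> fP x = q x by move=> ux; rewrite /fP; case: asboolP.
have fPP (x : M) : inP P x -> inP P (fP x).
  move=> Px; have [ux|ux] := pselect (inU x); first by rewrite fPU //; apply: (f_UP FN); exact: fU.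
  by rewrite fPQ //; case: (qQ x).
have fPinU (x : M) : inP P x -> inU (fP x) -> inU x.
  move=> Px; have [//|ux] := pselect (inU x); rewrite fPQ //.
  by have [_] : [set x : N | inP P x /\ ~ inU x]%classic (q x) by exact: qQ.
have [z0] := carrier_inhabited (frame_part FN).
have /choice[fh fhP] : forall x : frame_part FM, exists y : frame_part FN,
    inP P (sval x : M) -> sval y = fP (sval x).
  move=> x; have [Px|nP] := pselect (inP P (sval x : M)); last by exists z0.
  by exists (exist _ (fP (sval x)) (inP_old rarP FN (fPP _ Px))).
have cX : embeds (frame_part FM) nat := embeds_trans (embeds_sig _) cM.
have cY : embeds (frame_part FN) nat := embeds_trans (embeds_sig _) cN.
have [|hA ihA hAE] := countable_extension (f := fh) cth M0t cM0 indisc Mt Nt cX cY.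
  split.
  - by move=> x Px; rewrite /Defs.pred_set /= fhP //; exact: fPP.
  - move=> x y /set_mem Px /set_mem Py e; apply: sval_inj.
    have : fP (sval x) = fP (sval y) by rewrite -!fhP // e.
    have [ux|ux] := pselect (inU (sval x : M)); have [uy|uy] := pselect (inU (sval y : M)).
    + by rewrite !fPU // => /finj; apply; apply: mem_set; right.
    + by move=> e'; case: uy; apply: fPinU => //; rewrite -e' fPU //; exact: fU.
    + by move=> e'; case: ux; apply: fPinU => //; rewrite e' fPU //; exact: fU.
    + by rewrite !fPQ // => /qinj; apply; apply: mem_set.
  - move=> y Py; have [x Px xy] : exists2 x : M, inP P x & fP x = sval y.
      have [uy|uy] := pselect (inU (sval y : N)).
        have [|x [nx|ux] xy] := fsurj (sval y); first by right.
          by case: (fnew _ nx); rewrite xy; exact: (inU_old rarP FN uy).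
        by exists x; [exact: (f_UP FM)|rewrite fPU].
      have [|x [Px Ux] xy] := qsurj (sval y); first by split.
      by exists x => //; rewrite fPQ.
    exists (exist _ x (inP_old rarP FM Px)) => //.
    by apply: sval_inj; rewrite fhP.
have [[hA' hAK hAK'] hAf hAr] := ihA.
have /choice[h hP] : forall x : M, exists y : N,
    (forall o : old x, y = sval (hA (exist _ x o))) /\ (new x -> y = f x).
  move=> x; have [o|n] := pselect (old x); last by exists (f x); split.
  exists (sval (hA (exist _ x o))); split=> // o'; congr (sval (hA _)); exact: sval_inj.
have hold (x : frame_part FM) : h (sval x) = sval (hA x).
  by rewrite (proj1 (hP (sval x)) (svalP x)); congr (sval (hA _)); exact: sval_inj.
have hnew x : new x -> h x = f x by exact: (proj2 (hP x)).
have h_old (x : M) : old x -> old (h x).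
  by move=> o; rewrite -[x]/(sval (exist (@old V M) x o)) hold; exact: svalP.
have h_new (x : M) : new x -> new (h x) by move=> n; rewrite hnew //; exact: fnew.
have hold' (x : M) : old (h x) -> old x by move=> o; apply: contrapT => /h_new.
have hnew' (x : M) : new (h x) -> new x by move=> n /h_old.
have hE (x : M) : inP P x -> h x = fP x.
  move=> Px; rewrite -[x in h x]/(sval (exist (@old V M) x (inP_old rarP FM Px))) hold.
  by rewrite hAE // fhP.
have hUf (x : M) : inU x -> h x = f x by move=> ux; rewrite hE ?fPU //; exact: (f_UP FM).
have hU (x : M) : inU x <-> inU (h x).
  split=> ux; first by rewrite hUf //; exact: fU.
  have Px : inP P x.
    have ox : old x by apply: hold'; exact: (inU_old rarP FN ux).
    have := hAr P (fun=> exist _ x ox); rewrite /= => /proj2; apply.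
    by have := f_UP FN ux; rewrite -[x in h x]/(sval (exist (@old V M) x ox)) hold.
  by apply: fPinU => //; rewrite -hE.
exists h; split.
- rewrite -setTT_bijective; split=> //.
  + move=> x y _ _ e; have [ox|nx] := pselect (old x).
      have oy : old y by apply: hold'; rewrite -e; exact: h_old.
      move: e; rewrite -[x]/(sval (exist (@old V M) x ox)) -[y]/(sval (exist (@old V M) y oy)).
      by rewrite !hold => /sval_inj/(can_inj hAK) ->.
    have ny : new y by apply: hnew'; rewrite -e; exact: h_new.
    by move: e; rewrite !hnew // => /finj; apply; apply: mem_set; left.
  + move=> y _; have [oy|ny] := pselect (old y).
      by exists (sval (hA' (exist _ y oy))) => //; rewrite hold hAK'.
    have [|x [nx|ux] xy] := fsurj y; first by left.
      by exists x => //; rewrite hnew.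
    by case: ny; rewrite -xy; apply: (inU_old rarP FN); exact: fU.
- move=> g a; have [oa|/existsNP[i0 ni0]] := pselect (forall i, old (a i)).
    pose a' i : frame_part FM := exist _ (a i) (oa i).
    have := hold (finterp (frame_part FM) g a'); rewrite hAf /= => ->.
    by congr (finterp N g _); apply/funext => i; rewrite -hold.
  (* With a new argument present, [f_junk] returns the first such argument on both sides. *)
  have [i [ni imin]] := least_ordinal (Q := fun i => new (a i)) ni0.
  have le_i (j : 'I_(farity g)) : j < i -> old (a j) by move=> /imin/contrapT.
  rewrite (f_junk FM ni) // (@f_junk _ _ _ FN g (fun i => h (a i)) i) //; first exact: h_new.
  by move=> j /le_i/h_old.
- case=> [r|[[] []]] a.
  + have [oa|no] := pselect (forall i, old (a i)); last first.
      split=> hr; case: no => i; first exact: (f_rel FM hr).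
      by apply: hold'; exact: (f_rel FN hr).
    pose a' i : frame_part FM := exist _ (a i) (oa i).
    have := hAr r a'; rewrite /= => ->.
    rewrite (_ : (fun i => h (a i)) = fun i => sval (hA (a' i))) //.
    by apply/funext => i; rewrite -hold.
  + have -> : a = fun=> a ord0 by apply/funext => i; rewrite (ord1 i).
    by split; [exact: h_old|exact: hold'].
  + have -> : a = fun=> a ord0 by apply/funext => i; rewrite (ord1 i).
    exact: hU.
  + rewrite (vec2_eta a) vec2_map; set x := a _; set y := a _.
    change (below x y <-> below (h x) (h y)).
    have [[nx ny]|no] := pselect (new x /\ new y); first by rewrite !hnew //; exact: fbelow.
    split=> hb; case: no; first exact: (f_below FM hb).
    by have [/hnew' ? /hnew' ?] := f_below FN hb.
  + rewrite (vec3_eta a) vec3_map; set x := a _; set u := a _; set y := a _.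
    change (maps x u y <-> maps (h x) (h u) (h y)).
    have [[nx [uu ny]]|no] := pselect (new x /\ inU u /\ new y).
      by rewrite (hnew _ nx) (hnew _ ny) hUf //; exact: fmaps.
    split=> hm; case: no.
      have [nx [uu yx]] := f_dom FM hm; do 2!split=> //.
      by case: yx => [->//|/(f_below FM)[]].
    have [/hnew' nx [/hU uu yx]] := f_dom FN hm; do 2!split=> //; apply: hnew'.
    by case: yx => [->|/(f_below FN)[//]]; exact: h_new.
Qed.

End CountableFrames.

(** * Bounds, maximality and existence of models *)

Lemma elementary_rel (V : vocabulary) (M N : structure V) (j : M -> N) r (a : 'I_(rarity r) -> M) :
  elementary j -> rinterp M r a <-> rinterp N r (fun i => j (a i)).
Proof. by move=> je; exact: (je _ (Rel (fun i => Var V i)) a). Qed.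

(** Excluding size K^+ excludes all larger sizes: a model not embedding into K contains a copy of
    Kp, whose hull is a model of size K^+. *)
Lemma model_bound (V : vocabulary) (theta : sentence V) (A : structure V) K Kp :
  embeds nat K -> is_card_succ K Kp -> no_model_of_card_succ theta K -> models A theta ->
  embeds A K.
Proof.
move=> infK sK nom At; apply: contrapT => nAK; have [nKpK min] := proj1 (card_succP _ _) sK.
have [g gi] := min _ nAK.
have [|H [clH [inh [Hg HKp mH]]]] := lowenheim_skolem theta g.
  exact: embeds_trans infK (card_succ_embeds sK).
apply: nom; exists (substructure clH inh); split; first exact/mH.
have KpH : embeds Kp {x | H x}.
  by exists (fun k => exist _ (g k) (Hg k)) => x y /(congr1 sval) /= /gi.
apply/card_succP; split=> [h|T nT]; first exact: nKpK (embeds_trans KpH h).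
exact: embeds_trans HKp (min _ nT).
Qed.

Section Main.
Variables (V : vocabulary) (P : rsym V) (rarP : rarity P = 1).

(** If Kp embeds into L, its image is cofinal because segments embed into K; so L is a union of Kp
    many sets embedding into K. *)
Lemma frame_bound (M : structure (expansion V)) K Kp : frame P M ->
  embeds nat K -> is_card_succ K Kp -> embeds {x : M | old x} K -> embeds M Kp.
Proof.
move=> F infK sK oldK; have [nKpK _] := proj1 (card_succP _ _) sK.
have infKp := embeds_trans infK (card_succ_embeds sK).
have segK (x : M) : embeds {y | below y x} K.
  apply: embeds_trans (segment_embeds F x) _; apply: embeds_trans _ oldK.
  by apply: (@embeds_sig2 _ _ _ _ id) => // u /(inU_old rarP F).
have newKp : embeds {x : M | new x} Kp.
  have [//|[f fi]] := embeds_total {x : M | new x} Kp.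
  have /choice[k kP] : forall y : {x : M | new x}, exists k, ~ below (sval (f k)) (sval y).
    move=> y; apply: contrapT => /forallNP h; apply: nKpK.
    apply: embeds_trans (segK (sval y)).
    exists (fun k => exist (fun z => below z (sval y)) (sval (f k)) (contrapT (h k))).
    by move=> a b /(congr1 sval) /= /sval_inj/fi.
  (* [f i] may share the level of the point it bounds; a [t] above it makes the bound strict. *)
  have /choice[t tP] : forall i, exists t, below (sval (f i)) t.
    by move=> i; exact: (f_above F (svalP (f i))).
  have seg (y : {x : M | new x}) : below (sval y) (t (k y)).
    by have [h|//] := f_weak F (svalP y) (tP (k y)); case: (kP y).
  have [nK _] := infK.
  have /choice[s sP] : forall x : M, exists s : M -> K, forall y z,
      below y x -> below z x -> s y = s z -> y = z.
    move=> x; have [s0 s0i] := segK x.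
    have /choice[s sP] : forall y, exists i, forall h : below y x, i = s0 (exist _ y h).
      move=> y; have [h|nh] := pselect (below y x); last by exists (nK 0).
      by exists (s0 (exist _ y h)) => h'; congr s0; exact: sval_inj.
    by exists s => y z hy hz; rewrite (sP y hy) (sP z hz) => /s0i /(congr1 sval).
  apply: embeds_trans (embeds_prod_inf infKp (embeds_refl Kp) (card_succ_embeds sK)).
  exists (fun y => (k y, s (t (k y)) (sval y))) => y z [e].
  by move: (seg y) (seg z); rewrite e => sy sz /(sP _ _ _ sy sz)/sval_inj.
apply: (@embeds_trans ({x : M | old x} + {x : M | new x})).
  have /choice[f fP] : forall x : M, exists y : {x : M | old x} + {x : M | new x},
      match y with inl a => sval a = x | inr a => sval a = x end.
    by move=> x; have [o|n] := pselect (old x);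
      [exists (inl (exist _ x o))|exists (inr (exist _ x n))].
  by exists f => x y e; have := fP x; have := fP y; rewrite e; case: (f y) => a -> ->.
apply: embeds_sum_inf => //; exact: embeds_trans oldK (card_succ_embeds sK).
Qed.

Lemma maximal_frame (M : structure (expansion V)) (F : frame P M) :
  is_maximal (frame_part rarP F) -> ~ embeds {x : M | new x} {u : M | inU u} ->
  is_maximal M.
Proof.
move=> maxA small [N [j [je [b jb]]]].
have [phiF phiFP] := definable_frame P.
have FN : frame P N by apply/(phiFP N (@empty_env N)); apply/(elementary_models phiF je)/phiFP.
have jold (x : M) : old x <-> old (j x) by exact: elementary_rel.
have jU (x : M) : inU x <-> inU (j x) by exact: elementary_rel.
have jbelow (x y : M) : below x y <-> below (j x) (j y).
  by rewrite /below (elementary_rel _ je) vec2_map.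
have jmaps (x u y : M) : maps x u y <-> maps (j x) (j u) (j y).
  by rewrite /maps (elementary_rel _ je) vec3_map.
have jinj := elementary_inj je.
pose jA (x : frame_part rarP F) : frame_part rarP FN :=
  exist _ (j (sval x)) (proj1 (jold (sval x)) (svalP x)).
have jAe : elementary jA.
  by move=> n phi v; rewrite -!relativizeP je.
have onA (y : N) : old y -> exists x : M, j x = y.
  move=> oy; apply: contrapT => nx; apply: maxA; exists (frame_part rarP FN), jA; split=> //.
  exists (exist _ y oy) => x /(congr1 sval) /= e; apply: nx; by exists (sval x).
have nb : new b by move=> /onA[x]; exact: jb.
have onU (u : N) : inU u -> exists2 v : M, inU v & j v = u.
  by move=> uu; have [v e] := onA u (inU_old rarP FN uu); exists v => //; apply/jU; rewrite e.
(* Otherwise [b] is below [j y] for some [y] in M, so it is the value of g at [j y] and some member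
   of U. That member is some [j v], as U has not grown, and [b] would be the image of g(y,v). *)
have top (x : M) : new x -> below (j x) b.
  move=> nx; apply: contrapT => nxb; have [y xy] := f_above F nx.
  have [|h] := f_weak FN nb (proj1 (jbelow _ _) xy); first by [].
  have [u [/onU[v vU <-] m]] := f_reach FN h.
  have [z yz] := f_total F (proj2 (f_below F xy)) vU.
  by apply: (jb z); apply: (f_fun FN _ m); apply/jmaps.
apply: small.
have /choice[f fP] : forall x : {x : M | new x}, exists u : {u : M | inU u},
    maps b (j (sval u)) (j (sval x)).
  move=> [x nx]; have [u [/onU[v vU <-] m]] := f_reach FN (top x nx).
  by exists (exist _ v vU).
exists f => x y e; apply: sval_inj; apply: jinj.
by have fy := fP y; rewrite -e in fy; exact: (f_fun FN (fP x) fy).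
Qed.

(** The Los-Vaught test. Loewenheim-Skolem preserves one sentence at a time, hence its use on a
    conjunction with psi. *)
Lemma expansion_complete (theta : sentence V) (M0 : structure V) (psi : sentence (expansion V)) :
  complete theta -> models M0 theta -> embeds M0 nat -> absolute_indiscernibles M0 P ->
  (forall M, models M psi <-> exists F : frame P M, models (frame_part rarP F) theta) ->
  (exists M : structure (expansion V), models M psi) -> complete psi.
Proof.
move=> cth M0t cM0 ind psiP ex; split=> // sigma.
have [h|/existsNP[M1 /not_implyP[m1 s1]]] := pselect (entails psi (Neg sigma)); first by right.
have [h|/existsNP[M2 /not_implyP[m2 s2]]] := pselect (entails psi sigma); first by left.
exfalso; have small (M : structure (expansion V)) (phi : sentence (expansion V)) :
    models M psi -> models M phi -> exists N : structure (expansion V),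
      [/\ models N psi, models N phi & embeds N nat].
  move=> Mp Mph; have [x0] := carrier_inhabited M.
  have [H [clH [inh [_ cH mH]]]] :=
    lowenheim_skolem (and_formula psi phi) (fun _ : nat => x0) (embeds_refl nat).
  exists (substructure clH inh).
  by have /sat_and[] : models (substructure clH inh) (and_formula psi phi) by apply/mH/sat_and.
have [N1 [/psiP[F1 t1] n1 c1]] := small M1 sigma m1 (contrapT s1).
have [N2 [/psiP[F2 t2] n2 c2]] := small M2 (Neg sigma) m2 s2.
have [h /isomorphism_elementary he] := frame_isomorphism cth M0t cM0 ind t1 t2 c1 c2.
by apply: n2; apply/(elementary_models sigma he).
Qed.

(** * Assembling a model of psi from a model of theta and an action *)

Section Build.
Variables (N0 : structure V) (D L : Type) (lt : L -> L -> Prop) (g : L -> D -> L).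
Variables (e : D -> N0) (w : nat -> N0).
Hypotheses (full_g : full lt g) (L0 : inhabited L) (D0 : inhabited D).
Hypotheses (e_inj : injective e) (w_inj : injective w).
Hypotheses (eP : forall d, Defs.pred_set N0 P (e d)) (wP : forall n, Defs.pred_set N0 P (w n)).
Hypothesis we : forall n d, w n <> e d.

Let carr := (N0 + L)%type.

Definition built_rel (r : rsym (expansion V)) : ('I_(@rarity (expansion V) r) -> carr) -> Prop :=
  match r as r0 return ('I_(@rarity (expansion V) r0) -> carr) -> Prop with
  | inl r => fun a => exists b : 'I_(rarity r) -> N0, a = (fun i => inl (b i)) /\ rinterp N0 r b
  | inr (true, true) => fun a => exists x, a ord0 = inl x
  | inr (true, false) => fun a => exists d, a ord0 = inl (e d)
  | inr (false, true) => fun a => exists x y, a = vec2 (inr x) (inr y) /\ lt x y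
  | inr (false, false) => fun a => exists x d, a = vec3 (inr x) (inl (e d)) (inr (g x d))
  end.

(** A relation, since whether all arguments lie in N0 is decided only classically. The second clause
    anticipates [f_junk]. *)
Definition built_fun_spec (f : Defs.fsym V) (a : 'I_(farity f) -> carr) (y : carr) :=
  (forall b, a = (fun i => inl (b i)) -> y = inl (finterp N0 f b)) /\
  (forall i x, a i = inr x ->
    (forall j : 'I_(farity f), j < i -> exists b, a j = inl b) -> y = a i).

Lemma built_fun_exists : exists F : forall f : Defs.fsym V, ('I_(farity f) -> carr) -> carr,
  forall f a, built_fun_spec a (F f a).
Proof.
have /choice[F FP] : forall fa : {f : Defs.fsym V & 'I_(farity f) -> carr},
    exists y, built_fun_spec (tagged fa) y.
  move=> [f a] /=; have [[b ab]|nb] := pselect (exists b, a = fun i => inl (b i)).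
    exists (inl (finterp N0 f b)); split.
      move=> b' ab'; congr (inl (finterp _ _ _)); apply/funext => i.
      by have := congr1 (@^~ i) ab'; rewrite ab => -[].
    by move=> i x; rewrite ab.
  have [i0 [x0 ax0]] : exists i0 x0, a i0 = inr x0.
    apply: contrapT => h; apply: nb.
    have /choice[b bP] : forall i, exists b, a i = inl b.
      by move=> i; case ai: (a i) => [b|x]; [exists b|case: h; exists i, x].
    by exists b; apply/funext.
  have [i [[x ax] imin]] := least_ordinal (Q := fun i => exists x, a i = inr x)
    (ex_intro _ x0 ax0).
  exists (a i); split; first by move=> b ab; move: ax; rewrite ab.
  move=> i' x' ax' i'min; have [ii'|i'i|/val_inj-> //] := ltngtP i i'.
    by have [b] := i'min _ ii'; rewrite ax.
  by case: (imin _ i'i); exists x'.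
exists (fun f a => F (Tagged (fun f => 'I_(farity f) -> carr) a)) => f a; exact: FP (Tagged _ a).
Qed.

(** [e] lists U inside P, and [w] lists infinitely many elements of P outside U, for [f_coinf]. The
    isomorphism with N0 will carry maximality over to the theta-part. *)
Lemma built_exists : exists (M : structure (expansion V)) (F : frame P M),
  [/\ exists h : N0 -> frame_part rarP F, isomorphism h,
      embeds M (N0 + L), embeds (N0 + L) M, embeds L {x : M | new x}
    & embeds {u : M | inU u} D].
Proof.
have [Fu FuP] := built_fun_exists.
have [x00] := carrier_inhabited N0.
pose M : structure (expansion V) := @Structure (expansion V) carr (inhabits (inl x00)) Fu built_rel.
have oldE (x : M) : old x <-> exists y, x = inl y by [].
have newE (x : M) : new x <-> exists y, x = inr y.
  split; last by move=> [y ->] [].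
  by case: x => [x|x] nx; [case: nx; exists x|exists x].
have UE (x : M) : inU x <-> exists d, x = inl (e d) by [].
have PE (x : M) : inP P x <-> exists2 y, x = inl y & Defs.pred_set N0 P y.
  split=> [[b [xb Pb]]|[y -> Py]]; last by exists (fun=> y).
  pose i := cast_ord (esym rarP) ord0.
  exists (b i); first by have := congr1 (@^~ i) xb.
  rewrite /Defs.pred_set /=; suff <- : b = fun=> b i by [].
  apply/funext => j; congr b; apply: val_inj => /=.
  by move: j; rewrite rarP => j; rewrite (ord1 j).
have belowE (x y : M) : below x y <-> exists a b, [/\ x = inr a, y = inr b & lt a b].
  split=> [[a [b [ab h]]]|[a [b [-> -> h]]]]; last by exists a, b.
  exists a, b; have := congr1 (@^~ (@Ordinal 2 0 isT)) ab.
  have := congr1 (@^~ (@Ordinal 2 1 isT)) ab.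
  by rewrite /vec2 /= => -> ->.
have belowE' a b : below (inr a : M) (inr b) <-> lt a b.
  by rewrite belowE; split=> [[? [? [[->] [->]]]]|h]; last by exists a, b.
have mapsE (x u y : M) : maps x u y <-> exists a d, [/\ x = inr a, u = inl (e d) & y = inr (g a d)].
  split=> [[a [d ad]]|[a [d [-> -> ->]]]]; last by exists a, d.
  exists a, d; have := congr1 (@^~ (@Ordinal 3 0 isT)) ad.
  have := congr1 (@^~ (@Ordinal 3 1 isT)) ad.
  by have := congr1 (@^~ (@Ordinal 3 2 isT)) ad; rewrite /vec3 /= => -> -> ->.
have F : frame P M.
  split.
  - move=> f a /choice[b bP]; exists (finterp N0 f b).
    by apply: (proj1 (FuP f a)); apply/funext.
  - move=> f a i /newE[x ax] oa; exact: (proj2 (FuP f a) i x ax).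
  - by move=> r a [b [-> _]] i; exists (b i).
  - by move=> x /UE[d ->]; apply/PE; exists (e d).
  - move=> k c; have [n nc] : exists n, forall i, c i <> inl (w n).
      have fin : finite_set ((fun n => inl (w n) : M) @^-1` [set y | exists i, c i = y])%classic.
        by apply: finite_preimage; [move=> n m _ _ [/w_inj]|exact: finite_range].
      apply: contrapT => /forallNP h; apply: infinite_nat; apply: sub_finite_set fin => n _ /=.
      by apply: contrapT => no; apply: (h n) => i ci; apply: no; exists i.
    exists (inl (w n)); split; first by apply/PE; exists (w n).
    by split=> // /UE[d [/we]].
  - by have [l] := L0; exists (inr l); apply/newE; exists l.
  - by move=> x y /belowE[a [b [-> -> _]]]; split; apply/newE; eexists.
  - by move=> x /belowE[a [b [-> [->] /(full_irr full_g)]]].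
  - move=> x y z /belowE[a [b [-> -> ab]]] /belowE[b' [c [[<-] -> bc]]].
    by apply/belowE'; exact: (full_trans full_g ab bc).
  - move=> x y z /newE[b ->] /belowE[a [c [-> -> ac]]]; rewrite !belowE'.
    exact: (full_weak full_g _ ac).
  - move=> x y /belowE[a [b [-> -> /(full_dense full_g)[c [ac cb]]]]].
    by exists (inr c); rewrite !belowE'.
  - by move=> x /newE[a ->]; have [b ab] := full_above full_g a; exists (inr b); apply/belowE'.
  - by move=> x /newE[a ->]; have [b ab] := full_below full_g a; exists (inr b); apply/belowE'.
  - move=> x u y /mapsE[a [d [-> -> ->]]]; split; first by apply/newE; exists a.
    split; first by apply/UE; exists d.
    by rewrite belowE'; case: (full_reg full_g a d) => [->|]; [left|right].
  - move=> x u /newE[a ->] /UE[d ->]; exists (inr (g a d)); apply/mapsE; by exists a, d.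
  - move=> x u y z /mapsE[a [d [-> -> ->]]] /mapsE[a' [d' [[<-] [/e_inj<-] ->]]] //.
  - move=> m k a b c ainj ab.
    have /choice[a1 a1P] : forall i, exists x, a i = inr x by move=> i; apply/newE; case: (ab i).
    have /choice[b1 b1P] : forall i, exists x, b i = inr x.
      move=> i; have [_ [->|/belowE[x [_ [-> _ _]]]]] := ab i; [by exists (a1 i)|by exists x].
    have [d0] := D0.
    have /choice[c1 c1P] : forall i, exists d, c i = inl (e d) \/ forall d, c i <> inl (e d).
      move=> i; have [[d cd]|nd] := pselect (exists d, c i = inl (e d)); first by exists d; left.
      by exists d0; right=> d cd; apply: nd; exists d.
    have [||d [dc dP]] := full_row full_g (a := a1) (b := b1) c1.
    + by move=> i j e'; apply: ainj; rewrite !a1P e'.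
    + by move=> i; have [_] := ab i; rewrite a1P b1P belowE' => -[[->]|]; [left|right].
    exists (inl (e d)); split; first by apply/UE; exists d.
    split; last by move=> i; apply/mapsE; exists (a1 i), d; rewrite dP.
    by move=> i ci; case: (c1P i) => [|/(_ d)//]; rewrite ci => -[/e_inj/esym/dc].
  - move=> m k p b c x /newE[x1 ->] pinj pU.
    have /choice[p1 p1P] : forall i, exists d, p i = inl (e d) by move=> i; exact/UE/pU.
    have [l0] := L0.
    (* A [b i] from N0 is below nothing; its substitute [x1] is not below itself, so both prescribe
       [y] itself. *)
    have /choice[b1 b1P] : forall i, exists y, b i = inr y \/ y = x1 /\ ~ below (b i) (inr x1).
      move=> i; case: (b i) => [y|y]; last by exists y; left.
      by exists x1; right; split=> // /belowE[a [? []]].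
    have /choice[c1 c1P] : forall i, exists y, c i = inr y \/ forall z, c i <> inr z.
      by move=> i; case: (c i) => [y|y]; [exists l0; right|exists y; left].
    have [|y [xy yx cy yP]] := full_point full_g (p := p1) b1 c1 x1.
      by move=> i j e'; apply: pinj; rewrite !p1P e'.
    exists (inr y); rewrite !belowE'; split; first by apply/newE; exists y.
    do 2!split=> //; split.
      by move=> i ci; case: (c1P i) => [|/(_ y)//]; rewrite ci => -[/esym/cy].
    move=> i; have [h1 h2] := yP i; case: (b1P i) => [bi|[bi nb]].
      rewrite bi belowE' p1P; split=> [/h1 h|/h2 h]; apply/mapsE; by exists y, (p1 i); rewrite h.
    split=> // _; rewrite p1P; apply/mapsE; exists y, (p1 i); split=> //.
    by rewrite h2 // bi; exact: (full_irr full_g).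
  - move=> m p x /newE[x1 ->] pU.
    have /choice[p1 p1P] : forall i, exists d, p i = inl (e d) by move=> i; exact/UE/pU.
    have [k [c [[i ci] ccl]]] := full_finite full_g p1 x1.
    exists k, (fun i => inr (c i)); split; first by exists i; rewrite ci.
    split; first by move=> i'; apply/newE; exists (c i').
    move=> i' j; have [l h] := ccl i' j; exists l; apply/mapsE; exists (c i'), (p1 j).
    by rewrite h p1P.
exists M, F; split.
- exists (fun x => exist (@old V M) (inl x) (proj2 (oldE (inl x)) (ex_intro _ x erefl))); split.
  + rewrite -setTT_bijective; split=> //; first by move=> x y _ _ /(congr1 sval) [].
    by move=> [y /[dup] oy [x xy]] _; exists x => //; apply: sval_inj.
  + move=> f a; apply: sval_inj => /=; symmetry; exact: (proj1 (FuP f _) a).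
  + move=> r a; split=> [ra|[b [ab rb]]]; first by exists a.
    rewrite (_ : a = b) //; apply/funext => i.
    by have := congr1 (@^~ i) ab => -[].
- exact: embeds_refl.
- exact: embeds_refl.
- exists (fun l => exist (@new V M) (inr l) (proj2 (newE (inr l)) (ex_intro _ l erefl))).
  by move=> x y /(congr1 sval) [].
- have /choice[d dP] : forall u : {u : M | inU u}, exists d, sval u = inl (e d).
    by move=> u; apply/UE; exact: (svalP u).
  by exists d => u v duv; apply: sval_inj; rewrite !dP duv.
Qed.

End Build.
End Main.

(** * The two maximal models and the conclusion *)

Unset Implicit Arguments.

Theorem theorem1p6 (K Kp : Type) (V : vocabulary) (P : rsym V)
    (theta : sentence V) :
  infinite_set [set: K]%classic ->
  is_card_succ K Kp ->
  rarity P = 1%N ->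
  complete theta ->
  homogeneously_characterizes P theta K ->
  exists (W : vocabulary) (psi : sentence W),
    [/\ complete psi,
        characterizes psi Kp,
        exists N : structure W, [/\ models N psi, is_maximal N & has_card N K]
      & exists N : structure W, [/\ models N psi, is_maximal N & has_card N Kp]].
Proof.
move=> /infiniteP_embeds infK sK rarP cth [nom [M0 [M0t ctM0 ind]] [N0 [N0t maxN0 cardN0 cardP]]].
have {}ctM0 : embeds M0 nat by apply/embedsP.
have [N0K KN0] := proj1 (equipotentP _ _) cardN0.
have [phiF phiFP] := definable_frame P.
pose psi := and_formula phiF (relativize theta).
have psiP (M : structure (expansion V)) :
    models M psi <-> exists F : frame P M, models (frame_part rarP F) theta.
  have part (F : frame P M) : models M (relativize theta) <-> models (frame_part rarP F) theta.
    by rewrite /models -relativizeP (env0_eq (fun i => _ : M) (@empty_env M)).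
  rewrite {1}/models sat_and phiFP; split=> [[F h]|[F h]].
    by exists F; apply/part.
  by split=> //; apply/(part F).
(* The room for [D + nat] inside P provides U together with an infinite complement; maximality comes
   from |L| = |Dp| > |D| = |U|. *)
have build D Dp : embeds nat D -> is_card_succ D Dp -> embeds (D + nat) K ->
    exists N : structure (expansion V), [/\ models N psi, is_maximal N,
      embeds N (N0 + Dp) & embeds (N0 + Dp) N].
  move=> infD sD DK; have [L [lt [g [gfull LDp DpL]]]] := full_exists infD sD.
  have [i iinj] : embeds (D + nat) {x | Defs.pred_set N0 P x}.
    apply: embeds_trans DK _.
    move: (card_esym cardP) => /card_eqPle[/card_le_embeds h _].
    exact: embeds_trans (embeds_sigT K) h.
  have infDp := embeds_trans infD (card_succ_embeds sD).
  have [nL _] := embeds_trans infDp DpL.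
  have [nD _] := infD.
  have [|||||M [F [[h ih] ML LM Lnew UD]]] := @built_exists V P rarP N0 D L lt g
      (fun d => sval (i (inl d))) (fun n => sval (i (inr n)))
      gfull (inhabits (nL 0)) (inhabits (nD 0)).
  - by move=> d d' /sval_inj/iinj[].
  - by move=> d d' /sval_inj/iinj[].
  - by move=> d; exact: (svalP (i (inl d))).
  - by move=> d; exact: (svalP (i (inr d))).
  - by move=> n d /sval_inj/iinj.
  exists M; split.
  - apply/psiP; exists F; exact/(elementary_models theta (isomorphism_elementary ih)).
  - apply: (maximal_frame (F := F)); last first.
      move=> /(embeds_trans Lnew) h'; have [nDpD _] := proj1 (card_succP _ _) sD.
      by apply: nDpD; apply: embeds_trans DpL _; apply: embeds_trans h' UD.
    move=> [N' [j [je [b jb]]]]; apply: maxN0; exists N', (j \o h); split.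
      exact: elementary_comp (isomorphism_elementary ih) je.
    by exists b => a; exact: jb.
  - apply: embeds_trans ML _; apply: embeds_sum LDp; exact: embeds_refl.
  - apply: embeds_trans LM; apply: embeds_sum DpL; exact: embeds_refl.
have KKp := card_succ_embeds sK.
have infKp := embeds_trans infK KKp.
have [N1 [N1psi N1max N1le N1ge]] : exists N : structure (expansion V),
    [/\ models N psi, is_maximal N, embeds N (N0 + Kp) & embeds (N0 + Kp) N].
  by apply: (build K Kp infK sK); apply: embeds_sum_inf => //; exact: embeds_refl.
have card_N1 : has_card N1 Kp.
  apply/equipotentP; split.
    apply: embeds_trans N1le _; apply: embeds_sum_inf => //; last exact: embeds_refl.
    exact: embeds_trans N0K KKp.
  by apply: embeds_trans N1ge; exists inr => x y [].
exists (expansion V), psi; split.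
- by apply: (expansion_complete cth M0t ctM0 ind psiP); exists N1.
- split; [exact/infiniteP_embeds|by exists N1|].
  move=> [M [/psiP[F Mt] /card_succP[nM _]]]; apply: nM.
  apply: (frame_bound rarP F infK sK); exact: (model_bound infK sK nom Mt).
- have [Om sOm] := card_succ_exists nat.
  have nKnat : ~ embeds K nat.
    move=> h; apply: (maximal_uncountable cth M0t ctM0 ind N0t maxN0).
    exact: embeds_trans N0K h.
  have OmK : embeds Om K by have [_] := proj1 (card_succP _ _) sOm; apply.
  have [|N [Npsi Nmax Nle Nge]] := build nat Om (embeds_refl nat) sOm.
    exact: embeds_sum_inf.
  exists N; split=> //; apply/equipotentP; split.
    by apply: embeds_trans Nle _; exact: embeds_sum_inf.
  apply: embeds_trans KN0 _; apply: embeds_trans Nge; by exists inl => x y [].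
- by exists N1.
Qed.
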